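(* Let $L,T,\omega,b\in(0,\infty)$, let $\mathbf{e_g}\in\mathbb{R}^3$ with $|\mathbf{e_g}|=1$, let $\mathbf f:[0,L]\times[0,T]\to\mathbb{R}^3$ be continuous, and let $N\in\mathbb{N}$, $\tau=T/N$. For $k=1,\dots,N-1$ let $\mathbf r_{k+1}$ be the minimizer of $J_{k+1}$ on $\mathcal K_{k+1}$ and set $$\lambda_{k+1}:=-J'_{k+1}(\mathbf r_{k+1})(e'_{k+1})^{-1},$$ i.e. $\lambda_{k+1}[g]=-J'_{k+1}(\mathbf r_{k+1})\big[(e'_{k+1})^{-1}[g]\big]$ for $g\in\mathcal{H}^1_{0,L}(\Omega_L)$. Then $\lambda_{k+1}\in\mathcal{H}^{-1}(\Omega_L)$, and $(\mathbf r_{k+1},\lambda_{k+1})$ solves weakly the discrete fiber system $$\frac{\omega}{\tau^2}(\mathbf r_{k+1}-2\mathbf r_k+\mathbf r_{k-1})=\partial_s(\lambda_{k+1}\partial_s\mathbf r_k)-b\,\partial_{ssss}\mathbf r_{k+1}+\mathbf f_{k+1},\qquad(\partial_s\mathbf r_{k+1}-\partial_s\mathbf r_k)\cdot\partial_s\mathbf r_k=0,$$ that is, for all $\boldsymbol\phi\in\mathcal{H}^2_{0,L}(\Omega_L;\mathbb{R}^3)$, $$\omega(\mathrm D^2_{k+1}\mathbf r_{k+1},\boldsymbol\phi)_{\mathcal{L}^2(\Omega_L)}=-{}_{\mathcal{H}^1_{0,L}(\Omega_L)}\langle\partial_s\mathbf r_k\cdot\partial_s\boldsymbol\phi,\lambda_{k+1}\rangle_{\mathcal{H}^{-1}(\Omega_L)}-b(\partial_{ss}\mathbf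 r_{k+1},\partial_{ss}\boldsymbol\phi)_{\mathcal{L}^2(\Omega_L)}+(\mathbf f_{k+1},\boldsymbol\phi)_{\mathcal{L}^2(\Omega_L)},$$ and $$\partial_s(\mathbf r_{k+1}-\mathbf r_k)\cdot\partial_s\mathbf r_k=0 .$$
   Context: $\Omega_L=(0,L)$, $t_k=k\tau$, $\mathbf f_k=\mathbf f(\cdot,t_k)$. $\mathcal{H}^m=\mathcal{W}^{m,2}$; $\mathcal{H}^1_{0,L}(\Omega_L)=\{g\in\mathcal{H}^1(\Omega_L):g(L)=0\}$, $\mathcal{H}^2_{0,L}(\Omega_L;\mathbb{R}^3)=\{\mathbf v\in\mathcal{H}^2(\Omega_L;\mathbb{R}^3):\mathbf v(L)=\partial_s\mathbf v(L)=\mathbf 0\}$, $\mathcal{H}^{-1}(\Omega_L)=(\mathcal{H}^1_{0,L}(\Omega_L))'$, with ${}_{\mathcal B}\langle\cdot,\cdot\rangle_{\mathcal B'}$ the dual pairing. Let $\mathcal V=\{\mathbf v\in\mathcal{H}^2(\Omega_L;\mathbb{R}^3):\mathbf v(L)=\mathbf 0,\ \partial_s\mathbf v(L)=-\mathbf{e_g}\}$ and $\mathbf r_0(s)=\mathbf r_1(s)=(L-s)\mathbf{e_g}$. Recursively for $k=1,\dots,N-1$, given $\mathbf r_{k-1},\mathbf r_k\in\mathcal V$, put $\mathrm D^2_{k+1}\mathbf v=(\mathbf v-2\mathbf r_k+\mathbf r_{k-1})/\tau^2$, $$J_{k+1}(\mathbf v)=\omega\|\tau\mathrm D_{k+1}^2\mathbf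 v\|^2_{\mathcal{L}^2(\Omega_L)}+b\|\partial_{ss}\mathbf v\|^2_{\mathcal{L}^2(\Omega_L)}-2(\mathbf f_{k+1},\mathbf v)_{\mathcal{L}^2(\Omega_L)},\quad e_{k+1}(\mathbf v)=2\,\partial_s(\mathbf v-\mathbf r_k)\cdot\partial_s\mathbf r_k,$$ $\mathcal K_{k+1}=\{\mathbf v\in\mathcal V: e_{k+1}(\mathbf v)=0\}$; $\mathbf r_{k+1}$ is the unique minimizer of $J_{k+1}$ over $\mathcal K_{k+1}$. The derivative of $J_{k+1}$ is $J'_{k+1}(\mathbf v)[\boldsymbol\phi]=2\big(\omega(\mathrm D^2_{k+1}\mathbf v,\boldsymbol\phi)_{\mathcal{L}^2}+b(\partial_{ss}\mathbf v,\partial_{ss}\boldsymbol\phi)_{\mathcal{L}^2}-(\mathbf f_{k+1},\boldsymbol\phi)_{\mathcal{L}^2}\big)$, $\boldsymbol\phi\in\mathcal{H}^2_{0,L}(\Omega_L;\mathbb{R}^3)$. The notation $(e'_{k+1})^{-1}$ denotes the map $\mathcal{H}^1_{0,L}(\Omega_L)\to\mathcal{H}^2_{0,L}(\Omega_L;\mathbb{R}^3)$, $$(e'_{k+1})^{-1}[\psi](s)=-\int_s^L\frac{\psi\,\partial_u\mathbf r_k}{2|\partial_u\mathbf r_k|^2}\,du,$$ which is a right inverse of $e'_{k+1}[\boldsymbol\phi]=2\,\partial_s\mathbf r_k\cdot\partial_s\boldsymbol\phi$ (and is well defined because $|\partial_s\mathbf r_k|\ge1$ on $\Omega_L$). *)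

(* Defs.v *)
From HB Require Import structures.
From mathcomp Require Import all_boot all_order all_algebra.
From mathcomp Require Import all_classical all_reals all_analysis.
Set Implicit Arguments.
Unset Strict Implicit.
Unset Printing Implicit Defensive.
Import Order.TTheory GRing.Theory Num.Theory.
Import numFieldNormedType.Exports.
Local Open Scope classical_set_scope.
Local Open Scope ring_scope.

(* Functions on (0, L) or [0, L] are represented by total functions on R whose
   values outside the interval are irrelevant. *)

(* The library norm on 'rV is the sup norm, hence an explicit Euclidean one. *)
Definition dot (R : realType) (u v : 'rV[R]_3) : R :=
  \sum_(i < 3) u ord0 i * v ord0 i.

Definition enorm (R : realType) (u : 'rV[R]_3) : R := Num.sqrt (dot u u).

Definition coord (R : realType) (v : R -> 'rV[R]_3) (i : 'I_3) : R -> R :=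
  fun s => v s ord0 i.

Definition inL2 (R : realType) (L : R) (u : R -> R) : Prop :=
  u \_ `]0, L[ \in Lfun (@lebesgue_measure R) 2%:E.

(* Test functions of class C^1 with compact support in (0, L), as in Brezis,
   Functional Analysis, Sobolev Spaces and PDEs, section 8.2. *)
Definition test_function (R : realType) (L : R) (phi : R -> R) : Prop :=
  [/\ forall x, derivable phi x 1,
      continuous (derive1 phi) &
      exists a c : R, [/\ 0 < a, c < L & forall x, x \notin `[a, c] -> phi x = 0]].

Definition weak_derivative (R : realType) (L : R) (u g : R -> R) : Prop :=
  forall phi, test_function L phi ->
    \int[@lebesgue_measure R]_(x in `]0, L[) (u x * (derive1 phi) x) =
    - \int[@lebesgue_measure R]_(x in `]0, L[) (g x * phi x).

(* A class in H^1(0, L) is represented by its representative that is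
   continuous on [0, L]; boundary values are values of that representative. *)
Definition H1 (R : realType) (L : R) (u : R -> R) : Prop :=
  [/\ inL2 L u, {within `[0, L], continuous u} &
      exists g, inL2 L g /\ weak_derivative L u g].

Definition H2 (R : realType) (L : R) (u : R -> R) : Prop :=
  H1 L u /\ exists g, H1 L g /\ weak_derivative L u g.

(* For u in H^2, ds L u is the continuous representative of the weak
   derivative (unique on [0, L]); the value for other u is meaningless. *)
Definition ds (R : realType) (L : R) (u : R -> R) : R -> R :=
  xget (fun=> 0) [set g | H1 L g /\ weak_derivative L u g].

(* For u in H^1, wds L u is an L^2 representative of the weak derivative
   (unique almost everywhere); the value for other u is meaningless. *)
Definition wds (R : realType) (L : R) (u : R -> R) : R -> R :=
  xget (fun=> 0) [set g | inL2 L g /\ weak_derivative L u g].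

Definition dsv (R : realType) (L : R) (v : R -> 'rV[R]_3) : R -> 'rV[R]_3 :=
  fun s => \row_i ds L (coord v i) s.

Definition dssv (R : realType) (L : R) (v : R -> 'rV[R]_3) : R -> 'rV[R]_3 :=
  fun s => \row_i wds L (ds L (coord v i)) s.

Definition H2v (R : realType) (L : R) (v : R -> 'rV[R]_3) : Prop :=
  forall i, H2 L (coord v i).

Definition H1_0L (R : realType) (L : R) (g : R -> R) : Prop :=
  H1 L g /\ g L = 0.

Definition H2v_0L (R : realType) (L : R) (v : R -> 'rV[R]_3) : Prop :=
  [/\ H2v L v, v L = 0 & dsv L v L = 0].

Definition L2ip (R : realType) (L : R) (u v : R -> 'rV[R]_3) : R :=
  \int[@lebesgue_measure R]_(s in `]0, L[) dot (u s) (v s).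

Definition L2norm (R : realType) (L : R) (u : R -> 'rV[R]_3) : R :=
  Num.sqrt (L2ip L u u).

Definition H1norm (R : realType) (L : R) (g : R -> R) : R :=
  Num.sqrt (\int[@lebesgue_measure R]_(s in `]0, L[) (g s ^+ 2) +
            \int[@lebesgue_measure R]_(s in `]0, L[) (wds L g s ^+ 2)).

(* The dual of H^1_{0,L}: bounded linear functionals.  Linearity and
   boundedness force the value to depend only on the restriction of the
   argument to [0, L]. *)
Definition Hm1 (R : realType) (L : R) (lam : (R -> R) -> R) : Prop :=
  (forall (a : R) (g h : R -> R), H1_0L L g -> H1_0L L h ->
     lam (fun s => a * g s + h s) = a * lam g + lam h) /\
  (exists C : R, forall g, H1_0L L g -> `|lam g| <= C * H1norm L g).

Definition dual_pairing (R : realType) (g : R -> R) (lam : (R -> R) -> R) : R :=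
  lam g.

Definition admissible (R : realType) (L : R) (eg : 'rV[R]_3)
    (v : R -> 'rV[R]_3) : Prop :=
  [/\ H2v L v, v L = 0 & dsv L v L = - eg].

(* In the definitions below rp, rk and fk1 stand for r_{k-1}, r_k, f_{k+1}. *)

Definition D2 (R : realType) (tau : R) (rp rk v : R -> 'rV[R]_3) :
    R -> 'rV[R]_3 :=
  fun s => (tau ^+ 2)^-1 *: (v s - 2 *: rk s + rp s).

Definition J (R : realType) (L omega b tau : R) (fk1 rp rk v : R -> 'rV[R]_3) : R :=
  omega * L2norm L (fun s => tau *: D2 tau rp rk v s) ^+ 2
  + b * L2norm L (dssv L v) ^+ 2 - 2 * L2ip L fk1 v.

Definition dJ (R : realType) (L omega b tau : R) (fk1 rp rk v phi : R -> 'rV[R]_3) : R :=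
  2 * (omega * L2ip L (D2 tau rp rk v) phi
       + b * L2ip L (dssv L v) (dssv L phi) - L2ip L fk1 phi).

Definition constr (R : realType) (L : R) (rk v : R -> 'rV[R]_3) : R -> R :=
  fun s => 2 * dot (dsv L (fun t => v t - rk t) s) (dsv L rk s).

Definition feasible (R : realType) (L : R) (eg : 'rV[R]_3) (rk : R -> 'rV[R]_3) :
    set (R -> 'rV[R]_3) :=
  [set v | admissible L eg v /\ forall s, s \in `]0, L[ -> constr L rk v s = 0].

Definition minimizer (R : realType) (X : Type) (F : X -> R) (K : set X) (u : X) : Prop :=
  K u /\ forall v, K v -> F u <= F v.

Definition constr'_inv (R : realType) (L : R) (rk : R -> 'rV[R]_3) (psi : R -> R) :
    R -> 'rV[R]_3 :=
  fun s => \row_i (- \int[@lebesgue_measure R]_(u in `[s, L])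
    (psi u * dsv L rk u ord0 i / (2 * enorm (dsv L rk u) ^+ 2))).

Definition multiplier (R : realType) (L omega b tau : R)
    (fk1 rp rk rn : R -> 'rV[R]_3) : (R -> R) -> R :=
  fun g => - dJ L omega b tau fk1 rp rk rn (constr'_inv L rk g).

(* Main.v *)
(** In one dimension [H1 L u] with weak derivative [g] means that [u] is, on [[0, L]],
    a primitive of [g] (du Bois-Reymond).  In that form products and reciprocals are
    differentiated by comparing increments, so that [psi d / (2 |d|^2)], with
    [d = \partial_s r_k], lies in H^1 and [constr'_inv] maps [H1_0L] into [H2v_0L]
    with norm control; hence the multiplier is bounded.

    Tangents never shorten: [\partial_s (r_{k+1} - r_k)] is orthogonal to
    [\partial_s r_k], so [|\partial_s r_k| >= 1] follows by induction from [|eg| = 1].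

    If [\partial_s phi] is orthogonal to [\partial_s r_k], then [r_{k+1} + t phi] is
    feasible for every [t], and [J] is quadratic in [t]; hence [J'(r_{k+1})[phi] = 0].
    A general [phi] becomes such a direction after subtracting twice [constr'_inv] of
    [\partial_s r_k . \partial_s phi], which gives the weak equation. *)

Require Import Defs.
From HB Require Import structures.
From mathcomp Require Import all_boot all_order all_algebra.
From mathcomp Require Import all_classical all_reals all_analysis.
From mathcomp Require Import measurable_realfun ring lra.
Import Order.TTheory GRing.Theory Num.Theory.
Import numFieldNormedType.Exports.
Local Open Scope classical_set_scope.
Local Open Scope ring_scope.

Set Implicit Arguments.
Unset Strict Implicit.
Unset Printing Implicit Defensive.

(* [vector.coord] would otherwise shadow the coordinate function of the statement. *)
Local Notation coord := Defs.coord.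
Local Notation mu := lebesgue_measure.
Local Notation "\int_[ s , t ] f" := (Rintegral mu `]s, t[ f)
  (at level 36, f at level 36, format "\int_[ s ,  t ]  f") : ring_scope.

(** * Square-integrable functions *)

Section square_integrable.
Context {R : realType}.
Implicit Types (u v : R -> R) (D : set R).

(** [ds] and [wds] are choices made by [xget], so a known derivative can be matched with them only
    through uniqueness: everywhere on [[0, L]] for the continuous [ds], merely almost everywhere for
    [wds]. This is why second derivatives are always exchanged under an integral.

    The delicate point in bounding the multiplier is the second derivative of [constr'_inv L rk g].
    With q = d / (2 |d|^2) it equals q g' + g q', and q' is merely square integrable, so g has to be
    bounded in the sup norm. The boundary value g(L) = 0 does this: Cauchy-Schwarz gives g(s)^2 <= L
    \int g'^2.

    The coefficient two in the decomposition of phi comes from the constraint: its derivative is 2 d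
    . \partial_s phi, so its right inverse satisfies d . \partial_s ([constr'_inv] g) = g / 2,
    whereas the weak equation pairs the multiplier with d . \partial_s phi without the factor. The
    same two is the outer factor of [dJ], so they cancel at the end. *)

Definition sqint D u :=
  measurable_fun D u /\ mu.-integrable D (EFin \o (fun x => u x ^+ 2)).

Lemma integrable_addr D u v : measurable D ->
  mu.-integrable D (EFin \o u) -> mu.-integrable D (EFin \o v) ->
  mu.-integrable D (EFin \o (fun x => u x + v x)).
Proof. by move=> mD iu iv; exact: (@integrableD _ _ _ mu D mD _ _ iu iv). Qed.

Lemma integrable_scaler D (a : R) u : measurable D ->
  mu.-integrable D (EFin \o u) -> mu.-integrable D (EFin \o (fun x => a * u x)).
Proof. by move=> mD iu; exact: (@integrableZl _ _ _ mu D mD a _ iu). Qed.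

Lemma integrable_subr D u v : measurable D ->
  mu.-integrable D (EFin \o u) -> mu.-integrable D (EFin \o v) ->
  mu.-integrable D (EFin \o (fun x => u x - v x)).
Proof. by move=> mD iu iv; exact: (@integrableB _ _ _ mu D mD _ _ iu iv). Qed.

(** Domination by [u ^+ 2 + v ^+ 2], which bounds [|u v|] by the squares of [|u| - |v|] and
    [|u| + |v|]. *)
Lemma sqint_mul_integrable D u v : measurable D -> sqint D u -> sqint D v ->
  mu.-integrable D (EFin \o (fun x => u x * v x)).
Proof.
move=> mD [mu_ iu] [mv iv].
apply: (@le_integrable _ _ _ mu D mD _ (EFin \o (fun x => u x ^+ 2 + v x ^+ 2))) => //.
- by apply/measurable_EFinP; exact: measurable_funM.
- move=> x _ /=; rewrite lee_fin normrM -(real_normK (num_real (u x))) -(real_normK (num_real (v x))).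
  rewrite [leRHS]ger0_norm; last by rewrite addr_ge0 ?sqr_ge0.
  by have := sqr_ge0 (`|u x| - `|v x|); have := sqr_ge0 (`|u x| + `|v x|); nra.
- exact: integrable_addr.
Qed.

Lemma sqintD D u v : measurable D -> sqint D u -> sqint D v ->
  sqint D (fun x => u x + v x).
Proof.
move=> mD hu hv; have huv := sqint_mul_integrable mD hu hv.
case: hu hv => mu_ iu [mv iv].
split; first exact: measurable_funD.
have -> : (fun x => (u x + v x) ^+ 2) =
   (fun x => (u x ^+ 2 + v x ^+ 2) + 2 * (u x * v x)).
  by apply/funext => x; ring.
by apply: integrable_addr => //; [exact: integrable_addr|exact: integrable_scaler].
Qed.

Lemma sqintM_bounded D u v (M : R) : measurable D -> measurable_fun D v ->
  (forall x, D x -> `|v x| <= M) -> sqint D u -> sqint D (fun x => v x * u x).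
Proof.
move=> mD mv vM [mu_ iu]; split; first exact: measurable_funM.
apply: (@le_integrable _ _ _ mu D mD _ (EFin \o (fun x => M ^+ 2 * u x ^+ 2))) => //.
- by apply/measurable_EFinP; apply: measurable_funX; exact: measurable_funM.
- move=> x Dx /=; rewrite lee_fin ger0_norm ?sqr_ge0 // ger0_norm; last first.
    by rewrite (mulr_ge0 (sqr_ge0 M) (sqr_ge0 (u x))).
  rewrite exprMn; apply: ler_wpM2r; first exact: sqr_ge0.
  by have := vM _ Dx; rewrite ler_norml => /andP[]; nra.
- exact: integrable_scaler.
Qed.

Lemma sqintZ D (a : R) u : measurable D -> sqint D u -> sqint D (fun x => a * u x).
Proof. by move=> mD; apply: (@sqintM_bounded _ _ (fun=> a) `|a|). Qed.

Lemma sqintS D E u : measurable D -> measurable E -> D `<=` E ->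
  sqint E u -> sqint D u.
Proof.
move=> mD mE DE [mu_ iu]; split; first exact: measurable_funS mu_.
exact: integrableS iu.
Qed.

Lemma eq_sqint D u v : measurable D -> {in D, u =1 v} -> sqint D u -> sqint D v.
Proof.
move=> mD uv [mu_ iu]; split; first exact: eq_measurable_fun mu_.
apply: (@eq_integrable _ _ _ mu D mD _ _ _ iu) => x Dx /=.
by rewrite (uv _ Dx).
Qed.

(** The quadratic form a^2 B + 2 a b A + b^2 C, the integral of (a u + b v)^2, is nonnegative. At
    (C, -A) it equals C (B C - A^2), which settles C > 0. If C = 0 and A is nonzero, taking a = 1
    and b = -(B + 1) / A would give the negative value -B - 2. *)
Lemma cauchy_schwarz D u v : measurable D -> sqint D u -> sqint D v ->
  (\int[mu]_(x in D) (u x * v x)) ^+ 2 <=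
  (\int[mu]_(x in D) (u x ^+ 2)) * (\int[mu]_(x in D) (v x ^+ 2)).
Proof.
move=> mD hu hv.
have iuv := sqint_mul_integrable mD hu hv; have [_ iu] := hu; have [_ iv] := hv.
set A := \int[mu]_(x in D) (u x * v x); set B := \int[mu]_(x in D) (u x ^+ 2).
set C := \int[mu]_(x in D) (v x ^+ 2).
have B0 : 0 <= B by apply: Rintegral_ge0 => x _; exact: sqr_ge0.
have C0 : 0 <= C by apply: Rintegral_ge0 => x _; exact: sqr_ge0.
have key (a b : R) : 0 <= a ^+ 2 * B + 2 * a * b * A + b ^+ 2 * C.
  have : 0 <= \int[mu]_(x in D) ((a * u x + b * v x) ^+ 2).
    by apply: Rintegral_ge0 => x _; exact: sqr_ge0.
  rewrite (@eq_Rintegral _ _ _ mu D (fun x => (a ^+ 2 * u x ^+ 2 + 2 * a * b * (u x * v x)) + b ^+ 2 * v x ^+ 2)); last first.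
    by move=> x _; ring.
  have i1 : mu.-integrable D (EFin \o (fun x => a ^+ 2 * u x ^+ 2)).
    exact: integrable_scaler.
  have i2 : mu.-integrable D (EFin \o (fun x => 2 * a * b * (u x * v x))).
    exact: integrable_scaler.
  have i3 : mu.-integrable D (EFin \o (fun x => b ^+ 2 * v x ^+ 2)).
    exact: integrable_scaler.
  rewrite RintegralD //; last exact: integrable_addr.
  by rewrite RintegralD // !RintegralZl.
have [C00|C0'] := eqVneq C 0.
  have [->|A0] := eqVneq A 0; first by rewrite C00 expr0n /= mulr0.
  have := key 1 (- (B + 1) / A); rewrite C00 !mulr0 addr0 expr1n mul1r mulr1 -mulrA.
  by rewrite divfK //; nra.
have Cp : 0 < C by rewrite lt0r C0'.
have := key C (- A); rewrite -(ler_pM2l Cp); nra.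
Qed.

End square_integrable.

(** * Primitives of square-integrable functions *)

Section primitives.
Context {R : realType} (L : R).
Implicit Types (u v g h : R -> R).

(** [inL2] speaks of the extension by zero to the whole line, [sqint] of the function on the
    interval alone; the extension changes neither measurability nor the integral of the square. *)
Lemma inL2P u : inL2 L u <-> sqint `]0, L[ u.
Proof.
split=> [uL2|[mu_ iu]].
- have iu := Lfun2_integrable_sqr uL2.
  have : measurable_fun setT (u \_ `]0, L[).
    by move: uL2; rewrite /inL2 inE => /andP[]; rewrite inE.
  move=> mu_; split; first by apply/(measurable_restrictT _ _).2.
  apply/integrable_mkcond => //.
  apply: (@eq_integrable _ _ _ mu setT _ _ _ _ iu) => // x _ /=.
  by rewrite !patchE; case: ifPn => // _; rewrite expr0n.
- rewrite /inL2 inE; apply/andP; rewrite !inE /=; split.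
    by apply/(measurable_restrictT _ _).1.
  rewrite /finite_norm unlock /Lnorm; apply: poweR_lty.
  have /integrableP[_] := iu => iu2; rewrite integral_mkcond in iu2.
  apply: le_lt_trans iu2; rewrite le_eqVlt; apply/orP; left; apply/eqP.
  apply: eq_integral => x _ /=; rewrite !patchE; case: ifPn => _ /=.
    by rewrite powR_mulrn // normrX.
  by rewrite normr0 powR0.
Qed.

Lemma Rintegral_ooxx g (s : R) : \int_[s, s] g = 0.
Proof.
rewrite (_ : `]s, s[%classic = set0) ?Rintegral_set0 //.
by rewrite set_itv_ge // bnd_simp ltxx.
Qed.

Lemma Rintegral_oo_cat g (s t r : R) : mu.-integrable `]s, r[ (EFin \o g) ->
  s <= t -> t <= r -> \int_[s, r] g = \int_[s, t] g + \int_[t, r] g.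
Proof.
move=> ig st; rewrite le_eqVlt => /predU1P[->|tr].
  by rewrite Rintegral_ooxx addr0.
rewrite -(@Rintegral_itvB _ g (BRight s) (BLeft r) t) ?bnd_simp //.
rewrite -Rintegral_itv_bndo_bndc; first by rewrite addrC subrK.
apply: integrableS ig => //.
by apply: subset_itvl; rewrite bnd_simp ltW.
Qed.

Lemma sub_oo (s t : R) : 0 <= s -> t <= L -> `]s, t[ `<=` `]0, L[.
Proof. by move=> s0 tL; apply: subset_itv; rewrite bnd_simp. Qed.

Lemma integrable_sub_oo g (s t : R) : 0 <= s -> t <= L ->
  mu.-integrable `]0, L[ (EFin \o g) -> mu.-integrable `]s, t[ (EFin \o g).
Proof. by move=> s0 tL; apply: integrableS => //; exact: sub_oo. Qed.

Lemma sqint_cst (c : R) : sqint `]0, L[ (fun=> c).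
Proof.
split=> //; apply: measurable_bounded_integrable => //.
  by rewrite /= lebesgue_measure_itv /=; case: ifPn => // _; rewrite -EFinB ltry.
exact: bounded_cst.
Qed.

Lemma sqint_integrable g : sqint `]0, L[ g -> mu.-integrable `]0, L[ (EFin \o g).
Proof.
move=> hg; have := sqint_mul_integrable (measurable_itv _) hg (sqint_cst 1).
by under [X in EFin \o X]eq_fun do rewrite mulr1.
Qed.

(** Cauchy-Schwarz against the constant 1. This is the source of the uniform continuity of
    primitives and of the sup bound on functions vanishing at [L]. *)
Lemma Rintegral_oo_sqr_le g (s t : R) : sqint `]0, L[ g -> 0 <= s -> s <= t -> t <= L ->
  (\int_[s, t] g) ^+ 2 <= (t - s) * \int_[0, L] (fun x => g x ^+ 2).
Proof.
move=> hg s0 st tL.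
have hgst : sqint `]s, t[ g by apply: sqintS hg => //; exact: sub_oo.
have h1 : sqint `]s, t[ (fun=> 1 : R) by apply: sqintS (sqint_cst 1) => //; exact: sub_oo.
have := cauchy_schwarz (measurable_itv _) hgst h1.
under eq_Rintegral do rewrite mulr1.
move=> /le_trans; apply; rewrite mulrC; apply: ler_pM.
- by apply: Rintegral_ge0 => x _; rewrite sqr_ge0.
- by apply: Rintegral_ge0 => x _; exact: sqr_ge0.
- under eq_Rintegral do rewrite expr1n.
  rewrite Rintegral_cst // mul1r /= lebesgue_measure_itv /= lte_fin.
  by case: ltP => //= _; rewrite subr_ge0.
- have ig2 : mu.-integrable `]0, L[ (EFin \o (fun x => g x ^+ 2)) by case: hg.
  have gge0 (a b : R) : 0 <= \int_[a, b] (fun x => g x ^+ 2).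
    by apply: Rintegral_ge0 => x _; exact: sqr_ge0.
  rewrite (Rintegral_oo_cat ig2 s0 (le_trans st tL)).
  rewrite (@Rintegral_oo_cat _ s t L _ st tL); last exact: integrable_sub_oo ig2.
  by rewrite addrCA lerDl addr_ge0.
Qed.

Lemma abs_Rintegral_oo_le g a (e s t : R) : 0 <= s -> t <= L ->
  mu.-integrable `]0, L[ (EFin \o g) -> mu.-integrable `]0, L[ (EFin \o a) ->
  (forall x, s < x < t -> `|g x| <= e * a x) ->
  `|\int_[s, t] g| <= e * \int_[s, t] a.
Proof.
move=> s0 tL ig ia ga.
have igst := integrable_sub_oo s0 tL ig; have iast := integrable_sub_oo s0 tL ia.
rewrite (le_trans (le_normr_Rintegral _ igst)) // -RintegralZl //.
apply: le_Rintegral => //; first exact: integrable_norm.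
exact: integrable_scaler.
Qed.

(* The value at [L] is the anchor because of the boundary conditions and of the
   integral over [[s, L]] in [constr'_inv]. *)
Definition prim u g := sqint `]0, L[ g /\
  forall s, 0 <= s -> s <= L -> u s = u L - \int_[s, L] g.

Lemma primB u g (s t : R) : prim u g -> 0 <= s -> s <= t -> t <= L ->
  u t - u s = \int_[s, t] g.
Proof.
move=> [hg ug] s0 st tL; rewrite (ug t) ?(le_trans s0) // (ug s s0 (le_trans st tL)).
rewrite (@Rintegral_oo_cat g s t L) //; first by ring.
by apply: integrable_sub_oo => //; exact: sqint_integrable.
Qed.

Lemma prim_modulus u g (e : R) : prim u g -> 0 < e ->
  exists2 d : R, 0 < d & forall s t : R, 0 <= s -> s <= L -> 0 <= t -> t <= L ->
    `|t - s| < d -> `|u t - u s| < e.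
Proof.
move=> pu e0; have [hg _] := pu.
set C := \int_[0, L] (fun x => g x ^+ 2).
have C0 : 0 <= C by apply: Rintegral_ge0 => x _; exact: sqr_ge0.
have C1 : 0 < C + 1 by rewrite ltr_wpDl.
(* The squared increment is at most [C] times the length of the interval; [C + 1] replaces [C] so
   that the quotient makes sense when [C = 0]. *)
exists (e ^+ 2 / (C + 1)) => [|s t]; first by rewrite divr_gt0 ?exprn_gt0.
wlog st : s t / s <= t.
  move=> W s0 sL t0 tL h; have [st|/ltW ts] := leP s t; first exact: W.
  by rewrite distrC; apply: W => //; rewrite distrC.
move=> s0 sL t0 tL; rewrite ger0_norm ?subr_ge0 // ltr_pdivlMr // => h.
rewrite (primB pu) // -(ltr_pXn2r (_ : (0 < 2)%N)) ?nnegrE ?normr_ge0 ?ltW //.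
rewrite real_normK ?num_real //; apply: le_lt_trans (Rintegral_oo_sqr_le hg s0 st tL) _.
rewrite -/C; apply: le_lt_trans h; apply: ler_wpM2l; rewrite ?subr_ge0 //; lra.
Qed.

Lemma prim_continuous u g : prim u g -> {within `[0, L], continuous u}.
Proof.
move=> pu; apply/subspace_continuousP => x; rewrite /= in_itv /= => /andP[x0 xL].
apply/cvgrPdist_lt => e e0; have [d d0 H] := prim_modulus pu e0.
rewrite near_withinE; near=> y; rewrite /= in_itv /= => /andP[y0 yL].
apply: H => //; near: y.
Unshelve. all: by end_near. Qed.

Lemma sqint_continuous u : {within `[0, L], continuous u} -> sqint `]0, L[ u.
Proof.
move=> cu.
have mu_ : measurable_fun `]0, L[ u.
  apply: (@measurable_funS _ _ _ _ `[0, L]) => //; first exact: subset_itv_oo_cc.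
  by apply: subspace_continuous_measurable_fun.
have /compact_bounded[M [_ mrt]] := continuous_compact cu (@segment_compact _ 0 L).
have bu x : `]0, L[%classic x -> `|u x| <= `|M| + 1.
  move=> xI; apply: (mrt (`|M| + 1)); first by rewrite ltr_pwDr // ler_norm.
  by exists x => //; exact: subset_itv_oo_cc xI.
have := sqintM_bounded (measurable_itv _) mu_ bu (sqint_cst 1).
by apply: eq_sqint => // x _; rewrite mulr1.
Qed.

Lemma prim_sqint_fun u g : prim u g -> sqint `]0, L[ u.
Proof. by move=> /prim_continuous /sqint_continuous. Qed.

Lemma sqintM_continuous u g : {within `[0, L], continuous u} -> sqint `]0, L[ g ->
  sqint `]0, L[ (fun x => u x * g x).
Proof.
move=> cu.
have mu_ : measurable_fun `]0, L[ u by case: (sqint_continuous cu).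
have /compact_bounded[M [_ mrt]] := continuous_compact cu (@segment_compact _ 0 L).
apply: (@sqintM_bounded _ _ _ _ (`|M| + 1)) => // x xI.
apply: (mrt (`|M| + 1)); first by rewrite ltr_pwDr // ler_norm.
by exists x => //; exact: subset_itv_oo_cc xI.
Qed.

(* Increments of [u - \int g] are little-o of those of the nondecreasing function
   [\int a], so summing them over a fine partition gives zero. *)
Lemma prim_of_increments u g a :
  sqint `]0, L[ g -> mu.-integrable `]0, L[ (EFin \o a) ->
  (forall e : R, 0 < e -> exists2 d : R, 0 < d & forall s t : R, 0 <= s -> s <= t -> t <= L ->
     t - s < d -> `|u t - u s - \int_[s, t] g| <= e * \int_[s, t] a) ->
  prim u g.
Proof.
move=> hg ia H; have ig := sqint_integrable hg; split=> // s s0 sL.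
suff : u L - u s - \int_[s, L] g = 0 by lra.
apply/eqP; rewrite -normr_le0.
suff W (e : R) : 0 < e -> `|u L - u s - \int_[s, L] g| <= e * \int_[s, L] a.
  have A1 : 0 < `|\int_[s, L] a| + 1 by rewrite ltr_wpDl.
  apply/ler_addgt0Pr => e e0; rewrite add0r.
  apply: le_trans (W (e / (`|\int_[s, L] a| + 1)) (divr_gt0 e0 A1)) _.
  rewrite mulrAC ler_pdivrMr //; apply: ler_wpM2l; first exact: ltW.
  by rewrite (le_trans (ler_norm _)) // lerDl.
move=> e0; have [d d0 Hd] := H _ e0.
(* Induction on the number of pieces of length [d / 2] that cover [[p, q]], splitting off the last
   one. Half of [d] is used because the local estimate requires a length strictly below [d]. *)
suff K (n : nat) (p q : R) : 0 <= p -> p <= q -> q <= L -> q - p < n%:R * (d / 2) ->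
    `|u q - u p - \int_[p, q] g| <= e * \int_[p, q] a.
  have d20 : 0 < d / 2 by rewrite divr_gt0.
  apply: (K (Num.truncn ((L - s) / (d / 2))).+1) => //.
  by rewrite -ltr_pdivrMr // truncnS_gt.
elim: n p q => [|n IH] p q p0 pq qL.
  by rewrite mul0r subr_lt0 ltNge pq.
have [qpd _|qpd hn] := ltP (q - p) d; first exact: Hd.
pose m := q - d / 2.
have pm : p <= m by rewrite /m; lra.
have mq : m <= q by rewrite /m; lra.
have hpm : m - p < n%:R * (d / 2).
  by move: hn; rewrite /m -natr1 mulrDl mul1r; lra.
have := IH p m p0 pm (le_trans mq qL) hpm.
have := Hd m q (le_trans p0 pm) mq qL _.
rewrite (@Rintegral_oo_cat g p m q) ?(@Rintegral_oo_cat a p m q) //; try exact: integrable_sub_oo.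
have -> : q - m < d by rewrite /m; lra.
move=> /(_ isT); rewrite mulrDr !ler_norml => /andP[h1 h2] /andP[h3 h4].
by apply/andP; split; lra.
Qed.

End primitives.

(** * Sums, products and reciprocals of primitives *)

Section primitive_calculus.
Context {R : realType} (L : R) (L0 : 0 <= L).
Notation prim := (@prim R L).
Implicit Types (u v g h : R -> R).

Lemma eq_prim u v g : (forall s, 0 <= s -> s <= L -> u s = v s) -> prim u g -> prim v g.
Proof. by move=> uv [hg ug]; split=> // s s0 sL; rewrite -!uv // ug. Qed.

Lemma prim_cst (c : R) : prim (fun=> c) (fun=> 0).
Proof.
split; first exact: sqint_cst.
by move=> s _ _; rewrite Rintegral_cst // mul0r subr0.
Qed.

Lemma primD u v g h : prim u g -> prim v h ->
  prim (fun x => u x + v x) (fun x => g x + h x).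
Proof.
move=> [hg ug] [hh vh]; split; first exact: sqintD.
move=> s s0 sL; rewrite RintegralD //.
- by rewrite (ug s) // (vh s) //; ring.
- by apply: integrable_sub_oo => //; exact: sqint_integrable.
- by apply: integrable_sub_oo => //; exact: sqint_integrable.
Qed.

Lemma primZ (a : R) u g : prim u g -> prim (fun x => a * u x) (fun x => a * g x).
Proof.
move=> [hg ug]; split; first exact: sqintZ.
move=> s s0 sL; rewrite RintegralZl //.
- by rewrite (ug s) //; ring.
- by apply: integrable_sub_oo => //; exact: sqint_integrable.
Qed.

Lemma prim_sub u v g h : prim u g -> prim v h ->
  prim (fun x => u x - v x) (fun x => g x - h x).
Proof.
move=> pu /(primZ (-1)) pv; have := primD pu pv.
by under eq_fun do rewrite mulN1r; under [X in prim _ X]eq_fun do rewrite mulN1r.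
Qed.

Lemma prim_int g : sqint `]0, L[ g -> prim (fun s => - \int_[s, L] g) g.
Proof.
move=> hg; split=> // s s0 sL.
by rewrite (Rintegral_ooxx _ L) oppr0 sub0r.
Qed.

(** The increment of the product is v(t) (u(t) - u(s)) + u(s) (v(t) - v(s)), that is, the integral
    of g and h with weights frozen at the endpoints. Replacing v(t), u(s) by v(x), u(x) costs at
    most [e * (|g x| + |h x|)] on a short interval, by uniform continuity. *)
Lemma primM u v g h : prim u g -> prim v h ->
  prim (fun x => u x * v x) (fun x => v x * g x + u x * h x).
Proof.
move=> pu pv; have [hg _] := pu; have [hh _] := pv.
have cu := prim_continuous pu; have cv := prim_continuous pv.
have ig := sqint_integrable hg; have ih := sqint_integrable hh.
have hvg := sqintM_continuous cv hg; have huh := sqintM_continuous cu hh.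
have ivg := sqint_integrable hvg; have iuh := sqint_integrable huh.
apply: (@prim_of_increments _ _ _ _ (fun x => `|g x| + `|h x|)).
- exact: sqintD.
- by apply: integrable_addr => //; exact: integrable_norm.
move=> e e0; have [d1 d10 H1] := prim_modulus pu e0; have [d2 d20 H2] := prim_modulus pv e0.
exists (Num.min d1 d2); first by rewrite lt_min d10.
move=> s t s0 st tL; rewrite lt_min => /andP[td1 td2].
have sL := le_trans st tL; have t0 := le_trans s0 st.
have i1 : mu.-integrable `]0, L[ (EFin \o (fun x => v t * g x)) by exact: integrable_scaler.
have i2 : mu.-integrable `]0, L[ (EFin \o (fun x => u s * h x)) by exact: integrable_scaler.
have i3 : mu.-integrable `]0, L[ (EFin \o (fun x => v t * g x + u s * h x)).
  exact: integrable_addr.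
have i4 : mu.-integrable `]0, L[ (EFin \o (fun x => v x * g x + u x * h x)).
  exact: integrable_addr.
have -> : u t * v t - u s * v s - \int_[s, t] (fun x => v x * g x + u x * h x) =
  \int_[s, t] (fun x => (v t * g x + u s * h x) - (v x * g x + u x * h x)).
  rewrite RintegralB //; [|exact: integrable_sub_oo i3|exact: integrable_sub_oo i4].
  rewrite (@RintegralD _ _ _ mu _ (fun x => v t * g x) (fun x => u s * h x)) //;
    [|exact: integrable_sub_oo i1|exact: integrable_sub_oo i2].
  rewrite (@RintegralZl _ _ _ mu _ g) //; last exact: integrable_sub_oo ig.
  rewrite (@RintegralZl _ _ _ mu _ h) //; last exact: integrable_sub_oo ih.
  by rewrite -(primB pu) // -(primB pv) //; ring.
apply: (@abs_Rintegral_oo_le _ L) => //.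
- exact: (integrable_subr _ i3 i4).
- by apply: integrable_addr => //; exact: integrable_norm.
move=> x /andP[sx xt].
have x0 : 0 <= x by rewrite (le_trans s0) ?ltW.
have xL : x <= L by rewrite (le_trans _ tL) ?ltW.
have -> : v t * g x + u s * h x - (v x * g x + u x * h x) =
  (v t - v x) * g x + (u s - u x) * h x by ring.
rewrite mulrDr (le_trans (ler_normD _ _)) // !normrM.
have h1 : `|v t - v x| < e.
  by apply: H2 => //; rewrite ger0_norm; lra.
have h2 : `|u s - u x| < e.
  by apply: H1 => //; rewrite distrC ger0_norm; lra.
by apply: lerD; apply: ler_wpM2r => //; exact: ltW.
Qed.

Lemma primV u g : prim u g -> (forall s, 0 <= s -> s <= L -> 1 <= u s) ->
  prim (fun x => (u x)^-1) (fun x => - (u x)^-1 ^+ 2 * g x).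
Proof.
move=> pu u1; have [hg _] := pu; have ig := sqint_integrable hg.
have up x : 0 <= x -> x <= L -> u x != 0 by move=> *; rewrite gt_eqF // (lt_le_trans ltr01) ?u1.
have uV1 x : 0 <= x -> x <= L -> 0 < (u x)^-1 <= 1.
  by move=> *; rewrite invr_gt0 (lt_le_trans ltr01) ?u1 //= invf_le1 ?u1 // (lt_le_trans ltr01) ?u1.
have cV : {within `[0, L], continuous (fun x => - (u x)^-1 ^+ 2)}.
  apply/subspace_continuousP => x xI; have := xI; rewrite /= in_itv /= => /andP[x0 xL].
  have /subspace_continuousP/(_ x xI) cu := prim_continuous pu.
  apply: cvgN; rewrite expr2; under eq_fun do rewrite expr2.
  by apply: cvgM; apply: cvgV => //; exact: up.
have hVg := sqintM_continuous cV hg; have iVg := sqint_integrable hVg.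
apply: (@prim_of_increments _ _ _ _ (fun x => `|g x|)) => //; first exact: integrable_norm.
move=> e e0; have e20 : 0 < e / 2 by rewrite divr_gt0.
have [d d0 H] := prim_modulus pu e20; exists d => // s t s0 st tL std.
have sL := le_trans st tL; have t0 := le_trans s0 st.
have i1 : mu.-integrable `]0, L[ (EFin \o (fun x => - (u s * u t)^-1 * g x)).
  exact: integrable_scaler.
have -> : (u t)^-1 - (u s)^-1 - \int_[s, t] (fun x => - (u x)^-1 ^+ 2 * g x) =
  \int_[s, t] (fun x => - (u s * u t)^-1 * g x - - (u x)^-1 ^+ 2 * g x).
  rewrite RintegralB //; [|exact: integrable_sub_oo i1|exact: integrable_sub_oo iVg].
  rewrite (@RintegralZl _ _ _ mu _ g) //; last exact: integrable_sub_oo ig.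
  rewrite -(primB pu) //; congr (_ - _).
  by field; rewrite !up.
apply: (@abs_Rintegral_oo_le _ L) => //.
- exact: (integrable_subr _ i1 iVg).
- exact: integrable_norm.
move=> x /andP[sx xt].
have x0 : 0 <= x by rewrite (le_trans s0) ?ltW.
have xL : x <= L by rewrite (le_trans _ tL) ?ltW.
rewrite -mulrBl normrM; apply: ler_wpM2r => //.
have h1 : `|u t - u x| < e / 2 by apply: H => //; rewrite ger0_norm; lra.
have h2 : `|u s - u x| < e / 2 by apply: H => //; rewrite distrC ger0_norm; lra.
(* Telescoping through [(u x * u s)^-1]: each term changes one factor only. *)
have -> : - (u s * u t)^-1 - - (u x)^-1 ^+ 2 =
  (u x)^-1 * ((u x)^-1 * (u s)^-1) * (u s - u x) + (u s)^-1 * ((u x)^-1 * (u t)^-1) * (u t - u x).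
  by field; rewrite !up.
have bnd (a b c y : R) : 0 < a <= 1 -> 0 < b <= 1 -> 0 < c <= 1 -> `|a * (b * c) * y| <= `|y|.
  move=> /andP[/ltW a0 a1] /andP[/ltW b0 b1] /andP[/ltW c0 c1]; rewrite normrM; apply: ler_piMl => //.
  rewrite ger0_norm; last by rewrite mulr_ge0 // mulr_ge0.
  by apply: mulr_ile1 => //; [exact: mulr_ge0|exact: mulr_ile1].
rewrite (le_trans (ler_normD _ _)) // (splitr e); apply: lerD.
- by apply: le_trans (bnd _ _ _ _ (uV1 x x0 xL) (uV1 x x0 xL) (uV1 s s0 sL)) (ltW h2).
- by apply: le_trans (bnd _ _ _ _ (uV1 s s0 sL) (uV1 x x0 xL) (uV1 t t0 tL)) (ltW h1).
Qed.

End primitive_calculus.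

(** * Weak derivatives *)

Section weak_derivatives.
Context {R : realType} (L : R) (L0 : 0 < L).
Notation prim := (@prim R L).
Implicit Types (u v g h : R -> R).

(** Extended by zero, [g] has a vanishing indefinite integral on the whole line, whose derivative is
    [g] almost everywhere by Lebesgue differentiation. *)
Lemma prim0_ae g : prim (fun=> 0) g ->
  {ae mu, forall x, `]0, L[%classic x -> g x = 0}.
Proof.
move=> pg; have [hg _] := pg; have ig := sqint_integrable hg.
have iG : mu.-integrable setT (EFin \o (g \_ `]0, L[)).
  by have /integrable_mkcond := ig; rewrite restrict_EFin; apply.
have iGy y : mu.-integrable `]-oo, y] (EFin \o (g \_ `]0, L[)).
  exact: integrableS iG.
have lG : locally_integrable setT (g \_ `]0, L[) by exact: integrable_locally.
have := FTC1Ny iGy lG.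
have -> : (fun x => \int[mu]_(t in `]-oo, x]) (g \_ `]0, L[) t) = cst 0.
  apply/funext => x; rewrite -Rintegral_mkcondr /=.
  have I0 t : 0 <= t -> t <= L -> \int_[0, t] g = 0.
    by move=> t0 tL; rewrite -(primB pg) // subrr.
  have [x0|x0] := leP x 0.
    have -> : `]-oo, x] `&` `]0, L[ = set0 :> set R.
      by apply/seteqP; split=> // z; rewrite /= !in_itv /= => -[zx /andP[z0 _]]; lra.
    by rewrite Rintegral_set0.
  have [xL|Lx] := ltP x L.
    have -> : `]-oo, x] `&` `]0, L[ = `]0, x]%classic :> set R.
      apply/seteqP; split=> z; rewrite /= !in_itv /=; first by move=> [-> /andP[->]].
      by move=> /andP[-> zx]; rewrite zx (le_lt_trans zx).
    rewrite -Rintegral_itv_bndo_bndc; first by rewrite I0 ?ltW.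
    by apply: integrableS ig => //; apply: subset_itvl; rewrite bnd_simp ltW.
  have -> : `]-oo, x] `&` `]0, L[ = `]0, L[%classic :> set R.
    apply/seteqP; split=> z; rewrite /= !in_itv /=; first by move=> [_].
    by move=> /andP[-> zL]; rewrite zL (le_trans (ltW zL)).
  exact: I0 (ltW L0) (lexx L).
apply: filterS; first exact: (ae_filter_ringOfSetsType mu).
move=> x /= [_]; rewrite derive1_cst => /esym gx xI.
by move: gx; rewrite patchE mem_set.
Qed.

Lemma prim_unique_ae u v g h : prim u g -> prim v h ->
  (forall s, 0 <= s -> s <= L -> u s = v s) ->
  {ae mu, forall x, `]0, L[%classic x -> g x = h x}.
Proof.
move=> pu pv uv.
have : prim (fun=> 0) (fun x => g x - h x).
  by apply: (eq_prim (ltW L0) _ (prim_sub pu pv)) => s s0 sL; rewrite uv // subrr.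
move=> /prim0_ae; apply: filterS; first exact: (ae_filter_ringOfSetsType mu).
by move=> x H /H /subr0_eq.
Qed.

Lemma eq_Rintegral_ae g h : measurable_fun `]0, L[ g -> measurable_fun `]0, L[ h ->
  {ae mu, forall x, `]0, L[%classic x -> g x = h x} -> \int_[0, L] g = \int_[0, L] h.
Proof.
move=> mg mh gh; congr fine; apply: ae_eq_integral => //; try exact/measurable_EFinP.
move: gh; apply: filterS; first exact: (ae_filter_ringOfSetsType mu).
by move=> x H /H /= ->.
Qed.

Lemma prim_derive1 u : (forall x, derivable u x 1) -> continuous (derive1 u) ->
  prim u (derive1 u).
Proof.
move=> du cu.
have cW (a b : R) : {within `[a, b], continuous (derive1 u)} by exact: continuous_subspaceT.
split; first exact: sqint_continuous.
move=> s s0; rewrite le_eqVlt => /predU1P[->|sL]; first by rewrite Rintegral_ooxx subr0.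
have isL : mu.-integrable `[s, L] (EFin \o derive1 u).
  by apply: continuous_compact_integrable => //; exact: segment_compact.
have cu' x : {for x, continuous u} by exact/differentiable_continuous/derivable1_diffP.
rewrite Rintegral_itv_obnd_cbnd; last first.
  by apply: integrableS isL => //; exact: subset_itv_oo_cc.
rewrite Rintegral_itv_bndo_bndc; last first.
  by apply: integrableS isL => //; exact: subset_itv_co_cc.
rewrite /Rintegral (@continuous_FTC2 _ (derive1 u) u) //=; first by rewrite opprB addrC subrK.
split=> [x _||]; first exact: du.
- exact/cvg_at_right_filter/cu'.
- exact/cvg_at_left_filter/cu'.
Qed.

Lemma test_function_prim phi : test_function L phi ->
  [/\ prim phi (derive1 phi), phi 0 = 0 & phi L = 0].
Proof.
move=> [dphi cphi [a [c [a0 cL supp]]]]; split.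
- exact: prim_derive1.
- by apply: supp; rewrite in_itv /= leNgt a0.
- by apply: supp; rewrite in_itv /= (leNgt L) cL andbF.
Qed.

(** Integration by parts: the product rule [primM] applied to [u * phi], whose increment over
    [[0, L]] is zero because [phi] vanishes at both ends. *)
Lemma prim_weak_derivative u g : prim u g -> weak_derivative L u g.
Proof.
move=> pu phi /test_function_prim[pphi phi0 phiL].
have := primB (primM pu pphi) (lexx 0) (ltW L0) (lexx L).
rewrite phi0 phiL !mulr0 subr0 => /esym.
have i1 : mu.-integrable `]0, L[ (EFin \o (fun x => phi x * g x)).
  apply/sqint_integrable/sqintM_continuous; [exact: prim_continuous pphi|by case: pu].
have i2 : mu.-integrable `]0, L[ (EFin \o (fun x => u x * derive1 phi x)).
  apply/sqint_integrable/sqintM_continuous; [exact: prim_continuous pu|by case: pphi].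
rewrite RintegralD // => H; apply/eqP; rewrite -addr_eq0 addrC -[X in _ == X]H; apply/eqP.
by congr (_ + _); apply: eq_Rintegral => x _; rewrite mulrC.
Qed.

Lemma prim_H1 u g : prim u g -> H1 L u.
Proof.
move=> pu; split; first exact/inL2P/(prim_sqint_fun pu).
- exact: prim_continuous pu.
- by exists g; split; [apply/inL2P; case: pu|exact: prim_weak_derivative].
Qed.

(** If [k x] were positive, [k] would exceed [k x / 2] on some []x, y[] inside the interval and the
    integral would be positive. *)
Lemma continuous_ge0_Rintegral_eq0 (k : R -> R) : {within `[0, L], continuous k} ->
  (forall x, 0 < x < L -> 0 <= k x) -> \int_[0, L] k = 0 ->
  forall x, 0 < x < L -> k x = 0.
Proof.
move=> ck k0 ik0 x /andP[x0 xL]; apply/eqP/negPn/negP => kx0.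
have kx : 0 < k x by rewrite lt0r kx0 k0 // x0.
have ik : mu.-integrable `]0, L[ (EFin \o k) by exact/sqint_integrable/sqint_continuous.
have kge (a b : R) : 0 <= a -> b <= L -> 0 <= \int_[a, b] k.
  move=> a0 bL; apply: Rintegral_ge0 => y /=; rewrite in_itv /= => /andP[ay yb].
  by rewrite k0 // (le_lt_trans a0) //= (lt_le_trans yb).
have xI : `[0, L]%classic x by rewrite /= in_itv /= !ltW.
have /subspace_continuousP/(_ x xI)/cvgrPdist_lt/(_ (k x / 2)) := ck.
rewrite divr_gt0 // => /(_ isT); rewrite near_withinE => /nbhs_ballP[d /= d0 H].
have [y [xy yL yd]] : exists y, [/\ x < y, y <= L & y <= x + d / 2].
  exists (Num.min (x + d / 2) L).
  by split; rewrite ?lt_min ?ge_min ?lexx ?orbT // xL ltrDl divr_gt0.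
have ixL : mu.-integrable `]x, L[ (EFin \o k) by exact: integrable_sub_oo (ltW x0) (lexx L) ik.
have pos : 0 < (y - x) * (k x / 2) by rewrite mulr_gt0 ?subr_gt0 ?divr_gt0.
suff le : (y - x) * (k x / 2) <= \int_[x, y] k.
  have := kge 0 x (lexx _) (ltW xL); have := kge y L (ltW (lt_trans x0 xy)) (lexx _).
  move: ik0 (lt_le_trans pos le).
  rewrite (Rintegral_oo_cat ik (ltW x0) (ltW xL)) (Rintegral_oo_cat ixL (ltW xy) yL).
  move: (\int_[0, x] k) (\int_[x, y] k) (\int_[y, L] k) => A B C; clear; lra.
have -> : (y - x) * (k x / 2) = \int_[x, y] (fun=> k x / 2).
  by rewrite Rintegral_cst //= lebesgue_measure_itv /= lte_fin xy /= mulrC.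
apply: le_Rintegral => //.
- exact: integrable_sub_oo (ltW x0) yL (sqint_integrable (sqint_cst _ _)).
- exact: integrable_sub_oo (ltW x0) yL ik.
move=> z /=; rewrite in_itv /= => /andP[xz zy].
have : `|k x - k z| < k x / 2.
  apply: H; last rewrite in_itv /=.
    by rewrite -ball_normE /= ltr_norml; apply/andP; move: xz zy yd d0; clear; split; lra.
  by apply/andP; move: xz zy yL x0; clear; split; lra.
by rewrite ltr_norml => /andP[]; move: (k x) (k z) => a b; clear; lra.
Qed.

End weak_derivatives.

(** * The lemma of du Bois-Reymond and extension of estimates to the endpoints *)

Section du_bois_reymond.
Context {R : realType} (L : R) (L0 : 0 < L).
Notation prim := (@prim R L).
Implicit Types (u v g h : R -> R).

(** The retraction of the line onto [[0, L]]. Composing with it makes a function continuous on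
    [[0, L]] continuous everywhere, as test functions must have a continuous derivative on all of
    R. *)
Definition clamp (x : R) : R := Num.max 0 (Num.min x L).

Lemma clamp_itv x : `[0, L]%classic (clamp x).
Proof.
rewrite /clamp /= in_itv /= le_max lexx /= ge_max ge_min lexx orbT andbT.
exact: ltW.
Qed.

Lemma clamp_id x : 0 <= x -> x <= L -> clamp x = x.
Proof. by move=> x0 xL; rewrite /clamp min_l // max_r. Qed.

Lemma continuous_clamp : continuous clamp.
Proof.
move=> x.
have : {for x, continuous ((cst 0 : R -> R^o) \max ((id : R -> R^o) \min (cst L)))}.
  apply: continuous_max; first exact: cvg_cst.
  by apply: continuous_min; [exact: cvg_id|exact: cvg_cst].
exact.
Qed.

Lemma continuous_comp_clamp (w : R -> R) : {within `[0, L], continuous w} ->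
  continuous (w \o clamp).
Proof.
move=> /subspace_continuousP cw x.
apply: cvg_trans (cw _ (clamp_itv x)) => P /=.
rewrite nbhs_simpl /= => /(continuous_clamp).
rewrite nbhs_simpl /=; apply: filterS => y; apply; exact: clamp_itv.
Qed.

(** The primitive from minus infinity vanishes to the left of [a] by the support of [F], and to the
    right of [c] exactly because [F] has integral zero. *)
Lemma supported_primitive (a c : R) (F : R -> R) : 0 < a -> c < L -> continuous F ->
  (forall x, x \notin `[a, c] -> F x = 0) -> \int_[0, L] F = 0 ->
  exists2 phi, test_function L phi & derive1 phi = F.
Proof.
move=> a0 cL cF F0 iF0.
have F00 x : ~ `]0, L[%classic x -> F x = 0.
  move=> xI; apply: F0; apply/negP => xac; apply: xI; move: xac.
  by rewrite /= !in_itv /= => /andP[ax xc]; rewrite (lt_le_trans a0) //= (le_lt_trans xc).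
have Fr : F = F \_ `]0, L[.
  by apply/funext => x; rewrite patchE; case: ifPn => // /negP xI; rewrite F00 // => /mem_set.
have iI : mu.-integrable `]0, L[ (EFin \o F).
  by apply/sqint_integrable/sqint_continuous/continuous_subspaceT.
have iT : mu.-integrable setT (EFin \o F).
  by have /integrable_mkcond := iI; rewrite restrict_EFin -Fr; apply.
pose phi x := \int[mu]_(t in `]-oo, x]) F t.
have phiD x : derivable phi x 1 /\ derive1 phi x = F x.
  apply: (@continuous_FTC1 _ F -oo%O x (x + 1)) => //; first by rewrite ltrDl.
  - exact: integrableS iT.
  - by rewrite ltNyr.
  - exact: cF.
have phiE : derive1 phi = F by apply/funext => x; case: (phiD x).
exists phi => //; split=> [x||]; [by case: (phiD x)|by rewrite phiE|].
exists a, c; split=> // x; rewrite in_itv /= negb_and -!ltNge => /orP[xa|cx].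
  rewrite /phi (@eq_Rintegral _ _ _ mu _ (fun=> 0)) ?Rintegral_cst ?mul0r // => t.
  rewrite inE /= in_itv /= => tx; apply: F0; rewrite in_itv /= negb_and -!ltNge.
  by rewrite (le_lt_trans tx).
rewrite -[RHS]iF0 /phi Rintegral_mkcond [RHS]Rintegral_mkcond -Fr; congr Rintegral.
apply/funext => t; rewrite patchE; case: ifPn => // /negP tx.
apply/esym/F0; rewrite in_itv /= negb_and -!ltNge; apply/orP; right.
by rewrite ltNge; apply/negP => tc; apply: tx; rewrite inE /= in_itv /= (le_trans tc) ?ltW.
Qed.

(* With [eta] a bump on [[a, c]] and [m] the [eta]-mean of [w], the function
   [eta (w - m)] is the derivative of a test function, so [\int eta (w - m)^2 = 0]. *)
Lemma du_bois_reymond (w : R -> R) : {within `[0, L], continuous w} ->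
  (forall phi, test_function L phi -> \int_[0, L] (fun x => w x * derive1 phi x) = 0) ->
  forall s t, 0 < s < L -> 0 < t < L -> w s = w t.
Proof.
move=> cw wphi s t /andP[s0 sL] /andP[t0 tL].
(* [[a, c]] lies inside []0, L[] and contains both points in its interior; only these facts are
   kept. *)
pose a := Num.min s t / 2; pose c := (Num.max s t + L) / 2.
have a0 : 0 < a by rewrite divr_gt0 // lt_min s0.
have cL : c < L by rewrite /c ltr_pdivrMr // mulr_natr mulr2n ltrD2r gt_max sL.
have as_ : a < s.
  rewrite /a ltr_pdivrMr // (le_lt_trans (_ : _ <= s)) //; first by rewrite ge_min lexx.
  by rewrite mulr_natr mulr2n ltrDl.
have at_ : a < t.
  rewrite /a ltr_pdivrMr // (le_lt_trans (_ : _ <= t)) //; first by rewrite ge_min lexx orbT.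
  by rewrite mulr_natr mulr2n ltrDl.
have sc : s < c.
  rewrite /c ltr_pdivlMr // mulr_natr mulr2n; apply: ler_ltD => //.
  by rewrite le_max lexx.
have tc : t < c.
  rewrite /c ltr_pdivlMr // mulr_natr mulr2n; apply: ler_ltD => //.
  by rewrite le_max lexx orbT.
move: (a) (c) a0 cL as_ at_ sc tc => {a c} a c a0 cL as_ at_ sc tc.
(* The positive part of a parabola with roots [a] and [c]: continuous, positive on []a, c[] and zero
   outside. *)
pose eta x : R := Num.max 0 ((x - a) * (c - x)).
have ceta : continuous eta.
  move=> x.
  suff : {for x, continuous ((cst 0 : R -> R^o) \max (fun y => (y - a) * (c - y) : R^o))} by exact.
  apply: continuous_max; first exact: cvg_cst.
  apply: cvgM; first by apply: cvgB; [exact: cvg_id|exact: cvg_cst].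
  by apply: cvgB; [exact: cvg_cst|exact: cvg_id].
have eta_ge0 x : 0 <= eta x by rewrite le_max lexx.
have eta_gt0 x : a < x -> x < c -> 0 < eta x.
  by move=> ax xc; rewrite lt_max mulr_gt0 ?orbT ?subr_gt0.
have eta0 x : x \notin `[a, c] -> eta x = 0.
  rewrite in_itv /= negb_and -!ltNge => xac; apply/max_idPl.
  have ac : a < c by rewrite (lt_trans as_).
  by case/orP: xac => h; nra.
pose W := w \o clamp.
have cW : continuous W by exact: continuous_comp_clamp.
have WE x : 0 < x < L -> W x = w x.
  by move=> /andP[x0 xL]; rewrite /W /= clamp_id ?ltW.
have intc (f : R -> R) : continuous f -> mu.-integrable `]0, L[ (EFin \o f).
  by move=> cf; apply/sqint_integrable/sqint_continuous/continuous_subspaceT.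
have ieta_neq0 : \int_[0, L] eta != 0.
  apply/eqP => ie0; have sI : 0 < s < L by rewrite s0.
  have es := continuous_ge0_Rintegral_eq0 (continuous_subspaceT ceta)
    (fun x _ => eta_ge0 x) ie0 sI.
  by have := eta_gt0 _ as_ sc; rewrite es ltxx.
have cM (f g : R -> R) : continuous f -> continuous g -> continuous (fun x => f x * g x).
  by move=> cf cg x; apply: cvgM; [exact: cf|exact: cg].
pose m := (\int_[0, L] (fun x => eta x * W x)) / \int_[0, L] eta.
have cWm : continuous (fun x => W x - m).
  by move=> x; apply: cvgB; [exact: cW|exact: cvg_cst].
pose F x := eta x * (W x - m).
have cF : continuous F by exact: cM.
have iF : \int_[0, L] F = 0.
  rewrite (@eq_Rintegral _ _ _ mu _ (fun x => eta x * W x - m * eta x)); last first.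
    by move=> x _; rewrite /F; ring.
  rewrite RintegralB //; [|exact/intc/cM|].
    by rewrite RintegralZl ?intc // /m divfK // subrr.
  by apply: integrable_scaler => //; exact: intc.
have F0 x : x \notin `[a, c] -> F x = 0 by move=> /eta0; rewrite /F => ->; rewrite mul0r.
have [phi tphi phiE] := supported_primitive a0 cL cF F0 iF.
have := wphi _ tphi; rewrite phiE => iwF.
(* Both parts vanish: the one with [W] because [F] is the derivative of a test function, the one
   with [m] because [F] has mean zero. *)
have i2 : \int_[0, L] (fun x => F x * (W x - m)) = 0.
  rewrite (@eq_Rintegral _ _ _ mu _ (fun x => W x * F x - m * F x)); last first.
    by move=> x _; ring.
  rewrite RintegralB //; [|exact/intc/cM|].
    rewrite RintegralZl ?intc // iF mulr0 subr0 -[RHS]iwF.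
    by apply: eq_Rintegral => x; rewrite inE /= in_itv /= => xI; rewrite WE.
  by apply: integrable_scaler => //; exact: intc.
have E x : a < x -> x < c -> 0 < x < L -> w x = m.
  move=> ax xc xI; rewrite -WE //; apply/eqP; rewrite -subr_eq0 -sqrf_eq0; apply/eqP.
  apply: (mulfI (lt0r_neq0 (eta_gt0 _ ax xc))); rewrite mulr0 expr2 mulrA.
  apply: (continuous_ge0_Rintegral_eq0 _ _ i2 xI).
    by apply: continuous_subspaceT; exact: cM.
  by move=> y _; rewrite /F -mulrA -expr2 mulr_ge0 ?sqr_ge0.
by rewrite !E ?s0 ?sL ?t0 ?tL.
Qed.

Lemma interior_point_near (s d : R) : 0 <= s -> s <= L -> 0 < d ->
  exists y, [/\ 0 < y, y < L & `|s - y| < d].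
Proof.
(* The point is [s] moved towards the midpoint by the fraction [t], which treats both endpoints
   alike; [t * L <= d] makes the displacement at most [d / 2]. *)
move=> s0 sL d0; pose t := Num.min (1 / 2) (d / L).
have t0 : 0 < t by rewrite lt_min !divr_gt0.
have t1 : t <= 1 / 2 by rewrite ge_min lexx.
have td : t * L <= d by rewrite -ler_pdivlMr // ge_min lexx orbT.
move: t t0 t1 td => t t0 t1 td.
have h1 : 0 < t * L by rewrite mulr_gt0.
have h2 : 0 <= t * s by rewrite mulr_ge0 // ltW.
have h3 : 0 <= t * (L - s) by rewrite mulr_ge0 ?subr_ge0 // ltW.
have h4 : 0 <= (1 / 2 - t) * s by rewrite mulr_ge0 // subr_ge0.
have h5 : 0 <= (1 / 2 - t) * (L - s) by rewrite mulr_ge0 ?subr_ge0.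
exists (s + t * (L / 2 - s)).
by split; [lra|lra|rewrite ltr_norml; apply/andP; split; lra].
Qed.

(** Needed because the constraint is imposed on the open interval, while [primV] asks for the lower
    bound on the closed one. *)
Lemma prim_ge_closure u g (c : R) : prim u g -> (forall s, 0 < s < L -> c <= u s) ->
  forall s, 0 <= s -> s <= L -> c <= u s.
Proof.
move=> pu cu s s0 sL; apply/ler_addgt0Pr => e e0.
have [d d0 H] := prim_modulus pu e0.
have [y [y0 yL yd]] := interior_point_near s0 sL d0.
have := H y s (ltW y0) (ltW yL) s0 sL yd; rewrite ltr_norml => /andP[h1 _].
have := cu y; rewrite y0 yL => /(_ isT); move: h1.
by move: (u s) (u y) => a b; lra.
Qed.

Lemma continuous_const_closure (w : R -> R) (k : R) : {within `[0, L], continuous w} ->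
  (forall s, 0 < s < L -> w s = k) -> forall s, 0 <= s -> s <= L -> w s = k.
Proof.
move=> /subspace_continuousP cw wk s s0 sL.
have sI : `[0, L]%classic s by rewrite /= in_itv /= s0.
apply/eqP; rewrite -subr_eq0 -normr_le0; apply/ler_addgt0Pr => e e0; rewrite add0r.
have /cvgrPdist_lt/(_ e e0) := cw s sI.
rewrite near_withinE => /nbhs_ballP[d /= d0 H].
have [y [y0 yL yd]] := interior_point_near s0 sL d0.
rewrite -(wk y) ?y0 //; apply/ltW; apply: H; last by rewrite in_itv /= !ltW.
by rewrite -ball_normE.
Qed.

(** Converse of [prim_weak_derivative]: the difference between [u] and the primitive of [g] has weak
    derivative zero, hence is constant, first inside and then, by continuity, up to the
    endpoints. *)
Lemma weak_derivative_prim (u g : R -> R) : {within `[0, L], continuous u} ->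
  inL2 L g -> weak_derivative L u g -> prim u g.
Proof.
move=> cu /inL2P hg wg.
have pG := prim_int hg; have wG := prim_weak_derivative L0 pG.
have cG := prim_continuous pG.
set G := (fun s => - \int_[s, L] g) in pG wG cG.
have cw : {within `[0, L], continuous (fun x => u x - G x)}.
  exact: within_continuousB.
have w0 phi : test_function L phi ->
    \int_[0, L] (fun x => (u x - G x) * derive1 phi x) = 0.
  move=> tphi; have [[hphi _] _ _] := test_function_prim tphi.
  have iu : mu.-integrable `]0, L[ (EFin \o (fun x => u x * derive1 phi x)).
    by apply/sqint_integrable/sqintM_continuous.
  have iG : mu.-integrable `]0, L[ (EFin \o (fun x => G x * derive1 phi x)).
    by apply/sqint_integrable/sqintM_continuous.
  under eq_Rintegral do rewrite mulrBl.
  by rewrite RintegralB // wg // wG // subrr.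
have L20 : 0 < L / 2 < L by rewrite divr_gt0 //= ltr_pdivrMr // mulr_natr mulr2n ltrDl.
have W := continuous_const_closure cw (fun s sI => du_bois_reymond cw w0 sI L20).
have -> : g = (fun x => g x + 0) by apply/funext => x; rewrite addr0.
apply: (eq_prim (ltW L0) _ (primD pG (prim_cst L (u (L / 2) - G (L / 2))))) => s s0 sL.
by have := W s s0 sL; move: (u s) (G s) => a b; clear; lra.
Qed.

End du_bois_reymond.

(** * Vector-valued functions *)

Section strong_derivatives.
Context {R : realType} (L : R) (L0 : 0 < L).
Notation prim := (@prim R L).
Implicit Types (u g h k : R -> R) (v w : R -> 'rV[R]_3).

Lemma H1_prim_wds u : H1 L u -> prim u (wds L u).
Proof.
move=> [_ cu [g [hg wg]]].
have [hw ww] : inL2 L (wds L u) /\ weak_derivative L u (wds L u).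
  by apply: (@xgetPex _ (fun=> 0) [set g | inL2 L g /\ weak_derivative L u g]); exists g.
exact: weak_derivative_prim.
Qed.

Lemma H2_prim u : H2 L u -> prim u (ds L u) /\ prim (ds L u) (wds L (ds L u)).
Proof.
move=> [[_ cu _] [g [hg wg]]].
have [hd wd] : H1 L (ds L u) /\ weak_derivative L u (ds L u).
  by apply: (@xgetPex _ (fun=> 0) [set g | H1 L g /\ weak_derivative L u g]); exists g.
split; last exact: H1_prim_wds.
by apply: weak_derivative_prim => //; case: hd.
Qed.

Lemma prim_H2 u g k : prim u g -> prim g k -> H2 L u.
Proof.
move=> pu pg; split; first exact: prim_H1 pu.
by exists g; split; [exact: prim_H1 pg|exact: prim_weak_derivative].
Qed.

(** Almost everywhere equality makes the integral of (g - h)^2 vanish, and continuity turns this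
    into equality everywhere. It identifies [ds] with any continuous derivative found by hand. *)
Lemma prim_continuous_unique u g h : prim u g -> prim u h ->
  {within `[0, L], continuous g} -> {within `[0, L], continuous h} ->
  forall s, 0 <= s -> s <= L -> g s = h s.
Proof.
move=> pg ph cg ch.
have cd : {within `[0, L], continuous (fun x => g x - h x)} by exact: within_continuousB.
have cd2 : {within `[0, L], continuous (fun x => (g x - h x) * (g x - h x))}.
  by move=> x; apply: cvgM; exact: cd.
have i0 : \int_[0, L] (fun x => (g x - h x) * (g x - h x)) = 0.
  rewrite (@eq_Rintegral_ae _ L _ (fun=> 0)) ?Rintegral_cst ?mul0r //.
    by case: (sqint_continuous cd2).
  have := prim_unique_ae L0 pg ph (fun _ _ _ => erefl).
  apply: filterS; first exact: (ae_filter_ringOfSetsType mu).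
  by move=> x H /H ->; rewrite subrr mulr0.
have K : forall s, 0 < s < L -> g s - h s = 0.
  move=> s sI; apply/eqP; rewrite -sqrf_eq0 expr2; apply/eqP.
  apply: (continuous_ge0_Rintegral_eq0 cd2 _ i0 sI) => x _.
  by rewrite -expr2 sqr_ge0.
by move=> s s0 sL; apply/subr0_eq/(continuous_const_closure L0 cd K).
Qed.

Lemma ds_prim u g k : prim u g -> prim g k -> forall s, 0 <= s -> s <= L -> ds L u s = g s.
Proof.
move=> pu pg; have [pd pw] := H2_prim (prim_H2 pu pg).
exact: prim_continuous_unique pd pu (prim_continuous pw) (prim_continuous pg).
Qed.

Lemma wds_prim_ae u g h : (forall s, 0 <= s -> s <= L -> h s = u s) -> H1 L h -> prim u g ->
  {ae mu, forall x, `]0, L[%classic x -> wds L h x = g x}.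
Proof. by move=> hu /H1_prim_wds ph pu; exact: prim_unique_ae ph pu hu. Qed.

Definition vprim v w := forall i, prim (coord v i) (coord w i).

Definition vsqint v := forall i, sqint `]0, L[ (coord v i).

Lemma coord_dsv v i : coord (dsv L v) i = ds L (coord v i).
Proof. by apply/funext => s; rewrite /Defs.coord mxE. Qed.

Lemma coord_dssv v i : coord (dssv L v) i = wds L (ds L (coord v i)).
Proof. by apply/funext => s; rewrite /Defs.coord mxE. Qed.

Lemma H2v_prim v : H2v L v -> vprim v (dsv L v) /\ vprim (dsv L v) (dssv L v).
Proof.
by move=> hv; split=> i; rewrite ?coord_dssv !coord_dsv; case: (H2_prim (hv i)).
Qed.

Lemma vprim_H2v v w z : vprim v w -> vprim w z -> H2v L v.
Proof. by move=> vw wz i; exact: prim_H2 (vw i) (wz i). Qed.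

Lemma vprim_sqint v w : vprim v w -> vsqint v.
Proof. by move=> vw i; exact: prim_sqint_fun (vw i). Qed.

Lemma vprim_sqint_derivative v w : vprim v w -> vsqint w.
Proof. by move=> vw i; case: (vw i). Qed.

Lemma dsv_prim v w z : vprim v w -> vprim w z ->
  forall s, 0 <= s -> s <= L -> dsv L v s = w s.
Proof.
move=> vw wz s s0 sL; apply/rowP => i; rewrite mxE.
by rewrite (ds_prim (vw i) (wz i)).
Qed.

Lemma dssv_prim_ae v w z : vprim v w -> vprim w z -> forall i,
  {ae mu, forall x, `]0, L[%classic x -> coord (dssv L v) i x = coord z i x}.
Proof.
move=> vw wz i; rewrite coord_dssv.
apply: wds_prim_ae (wz i); first by move=> s s0 sL; rewrite (ds_prim (vw i) (wz i)).
exact: (prim_H1 L0 (H2_prim (prim_H2 (vw i) (wz i))).2).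
Qed.

Lemma coord_lin (a : R) v w i :
  coord (fun s => a *: v s + w s) i = (fun s => a * coord v i s + coord w i s).
Proof. by apply/funext => s; rewrite /Defs.coord !mxE. Qed.

Lemma vprim_lin (a : R) v w v' w' : vprim v v' -> vprim w w' ->
  vprim (fun s => a *: v s + w s) (fun s => a *: v' s + w' s).
Proof.
by move=> vv ww i; rewrite !coord_lin; exact: primD (primZ a (vv i)) (ww i).
Qed.

Lemma vsqint_lin (a : R) v w : vsqint v -> vsqint w ->
  vsqint (fun s => a *: v s + w s).
Proof.
move=> hv hw i; rewrite coord_lin.
by apply: sqintD => //; apply: sqintZ => //; exact: hv.
Qed.

(** Weak derivatives only see the open interval, so [xget] chooses from the same set and the results
    are equal as functions. This lets [dJ] accept identities valid only on []0, L[]. *)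
Lemma eq_ds u1 u2 : (forall s, 0 < s < L -> u1 s = u2 s) -> ds L u1 = ds L u2.
Proof.
move=> u12; rewrite /ds; congr xget; apply/seteqP; split=> g [hg wg]; split=> // phi tphi.
  rewrite -wg //; apply: eq_Rintegral => x; rewrite inE /= in_itv /= => xI.
  by rewrite u12.
rewrite -wg //; apply: eq_Rintegral => x; rewrite inE /= in_itv /= => xI.
by rewrite u12.
Qed.

Lemma eq_dssv v w : (forall s, 0 < s < L -> v s = w s) -> dssv L v = dssv L w.
Proof.
move=> vw; have e : (fun i => ds L (coord v i)) = (fun i => ds L (coord w i)).
  by apply/funext => i; apply: eq_ds => s sI; rewrite /Defs.coord vw.
exact: (congr1 (fun (h : 'I_3 -> R -> R) s => \row_i wds L (h i) s) e).
Qed.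

Lemma L2ipC v w : L2ip L v w = L2ip L w v.
Proof.
by apply: eq_Rintegral => s _; apply: eq_bigr => i _; rewrite mulrC.
Qed.

Lemma eq_L2ipr v w z : (forall s, 0 < s < L -> w s = z s) -> L2ip L v w = L2ip L v z.
Proof.
by move=> wz; apply: eq_Rintegral => s; rewrite inE /= in_itv /= => sI; rewrite wz.
Qed.

Lemma L2ipE v w : vsqint v -> vsqint w ->
  L2ip L v w = \sum_(i < 3) \int_[0, L] (fun s => coord v i s * coord w i s).
Proof.
move=> hv hw.
have ivw i : mu.-integrable `]0, L[ (EFin \o (fun s => coord v i s * coord w i s)).
  exact: sqint_mul_integrable.
have K (r : seq 'I_3) :
   mu.-integrable `]0, L[ (EFin \o (fun s => \sum_(i <- r) (coord v i s * coord w i s))) /\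
   \int_[0, L] (fun s => \sum_(i <- r) (coord v i s * coord w i s)) =
   \sum_(i <- r) \int_[0, L] (fun s => coord v i s * coord w i s).
  elim: r => [|i r [IH1 IH2]].
    have -> : (fun s => \sum_(i <- [::]) (coord v i s * coord w i s)) = (fun=> 0).
      by apply/funext => s; rewrite big_nil.
    rewrite big_nil Rintegral_cst ?mul0r //.
    by split=> //; exact/sqint_integrable/sqint_cst.
  have -> : (fun s => \sum_(j <- i :: r) (coord v j s * coord w j s)) =
      (fun s => coord v i s * coord w i s + \sum_(j <- r) (coord v j s * coord w j s)).
    by apply/funext => s; rewrite big_cons.
  rewrite big_cons; split; first exact: integrable_addr.
  by rewrite RintegralD // IH2.
by have [_ <-] := K (index_enum 'I_3).
Qed.

Lemma L2ip_linr (a : R) v w z : vsqint v -> vsqint w -> vsqint z ->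
  L2ip L v (fun s => a *: w s + z s) = a * L2ip L v w + L2ip L v z.
Proof.
move=> hv hw hz; rewrite !L2ipE //; last exact: vsqint_lin.
rewrite mulr_sumr -big_split; apply: eq_bigr => i _ /=.
have i1 := sqint_mul_integrable (measurable_itv _) (hv i) (hw i).
have i2 := sqint_mul_integrable (measurable_itv _) (hv i) (hz i).
rewrite -RintegralZl // -RintegralD //; last exact: integrable_scaler.
by apply: eq_Rintegral => s _; rewrite coord_lin; ring.
Qed.

Lemma L2ip_linl (a : R) v w z : vsqint v -> vsqint w -> vsqint z ->
  L2ip L (fun s => a *: w s + z s) v = a * L2ip L w v + L2ip L z v.
Proof. by move=> hv hw hz; rewrite L2ipC L2ip_linr // !(L2ipC v). Qed.

Lemma L2ip_aer v w z : vsqint v -> vsqint w -> vsqint z ->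
  (forall i, {ae mu, forall x, `]0, L[%classic x -> coord w i x = coord z i x}) ->
  L2ip L v w = L2ip L v z.
Proof.
move=> hv hw hz wz; rewrite !L2ipE //; apply: eq_bigr => i _.
have [mv _] := hv i; have [mw _] := hw i; have [mz _] := hz i.
apply: eq_Rintegral_ae; [exact: measurable_funM|exact: measurable_funM|].
have := wz i; apply: filterS; first exact: (ae_filter_ringOfSetsType mu).
by move=> x H /H ->.
Qed.

Lemma L2norm_sqr v : L2norm L v ^+ 2 = L2ip L v v.
Proof.
rewrite sqr_sqrtr //; apply: Rintegral_ge0 => s _.
by apply: sumr_ge0 => i _; rewrite -expr2 sqr_ge0.
Qed.

(** [dssv] is linear only almost everywhere, being a choice of representative; inside an inner
    product this suffices. *)
Lemma L2ip_dssv_lin (a : R) v w z : vsqint v -> H2v L w -> H2v L z ->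
  L2ip L v (dssv L (fun s => a *: w s + z s)) =
  a * L2ip L v (dssv L w) + L2ip L v (dssv L z).
Proof.
move=> hv /H2v_prim[w1 w2] /H2v_prim[z1 z2].
have p1 := vprim_lin a w1 z1; have p2 := vprim_lin a w2 z2.
have [q1 q2] := H2v_prim (vprim_H2v p1 p2).
have <- := L2ip_linr a hv (vprim_sqint_derivative w2) (vprim_sqint_derivative z2).
apply: (L2ip_aer hv); last exact: dssv_prim_ae p1 p2.
- exact: vprim_sqint_derivative q2.
- exact: vprim_sqint_derivative p2.
Qed.

End strong_derivatives.

(** * First variation *)

Section first_variation.
Context {R : realType} (L : R) (L0 : 0 < L).
Implicit Types (v w phi psi : R -> 'rV[R]_3).

Lemma dotC (x y : 'rV[R]_3) : dot x y = dot y x.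
Proof. by apply: eq_bigr => i _; rewrite mulrC. Qed.

Lemma dot_linl (a : R) (x y z : 'rV[R]_3) : dot (a *: x + y) z = a * dot x z + dot y z.
Proof.
by rewrite /dot mulr_sumr -big_split; apply: eq_bigr => i _; rewrite !mxE /= mulrDl mulrA.
Qed.

Lemma dotDsqr (x y : 'rV[R]_3) : dot (x + y) (x + y) = dot x x + 2 * dot x y + dot y y.
Proof.
have e (z : 'rV[R]_3) : dot (x + y) z = dot x z + dot y z.
  by rewrite -[X in dot (X + _)]scale1r dot_linl mul1r.
by rewrite e (dotC x) e (dotC y (x + y)) e (dotC y x); ring.
Qed.

Lemma H2v_lin (a : R) v w : H2v L v -> H2v L w -> H2v L (fun s => a *: v s + w s).
Proof.
move=> /(H2v_prim L0)[v1 v2] /(H2v_prim L0)[w1 w2].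
exact: (vprim_H2v L0 (vprim_lin a v1 w1) (vprim_lin a v2 w2)).
Qed.

Lemma dsv_lin (a : R) v w : H2v L v -> H2v L w -> forall s, 0 <= s -> s <= L ->
  dsv L (fun t => a *: v t + w t) s = a *: dsv L v s + dsv L w s.
Proof.
move=> /(H2v_prim L0)[v1 v2] /(H2v_prim L0)[w1 w2].
exact: (dsv_prim L0 (vprim_lin a v1 w1) (vprim_lin a v2 w2)).
Qed.

Lemma sub_linE v w : (fun t => v t - w t) = (fun t => (-1) *: w t + v t).
Proof. by apply/funext => t; rewrite scaleN1r addrC. Qed.

Lemma dsv_sub v w : H2v L v -> H2v L w -> forall s, 0 <= s -> s <= L ->
  dsv L (fun t => v t - w t) s = dsv L v s - dsv L w s.
Proof.
by move=> hv hw s s0 sL; rewrite sub_linE dsv_lin // scaleN1r addrC.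
Qed.

Lemma H2v_sqint v : H2v L v -> vsqint L v.
Proof. by move=> /(H2v_prim L0)[v1 _]; exact: vprim_sqint v1. Qed.

Lemma dssv_sqint v : H2v L v -> vsqint L (dssv L v).
Proof. by move=> /(H2v_prim L0)[_ v2]; exact: vprim_sqint_derivative v2. Qed.

Lemma vsqintZ (c : R) v : vsqint L v -> vsqint L (fun s => c *: v s).
Proof.
move=> hv i; have -> : Defs.coord (fun s => c *: v s) i = (fun s => c * Defs.coord v i s).
  by apply/funext => s; rewrite /Defs.coord mxE.
by apply: sqintZ => //; exact: hv.
Qed.

Lemma vsqint_sum v w : vsqint L v -> vsqint L w -> vsqint L (fun s => v s + w s).
Proof.
move=> hv hw; have := vsqint_lin 1 hv hw.
by rewrite (_ : (fun s => _) = (fun s => v s + w s)) //; apply/funext => s; rewrite scale1r.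
Qed.

Lemma L2ipZl (c : R) v w : vsqint L v -> vsqint L w ->
  L2ip L (fun s => c *: v s) w = c * L2ip L v w.
Proof.
move=> hv hw; rewrite !L2ipE //; last exact: vsqintZ.
rewrite mulr_sumr; apply: eq_bigr => i _.
rewrite -RintegralZl //; last exact: sqint_mul_integrable.
by apply: eq_Rintegral => s _; rewrite /Defs.coord mxE mulrA.
Qed.

Lemma D2_sqint (tau : R) rp rk v : vsqint L rp -> vsqint L rk -> vsqint L v ->
  vsqint L (D2 tau rp rk v).
Proof.
move=> hp hk hv.
have -> : D2 tau rp rk v = (fun s => (tau ^+ 2)^-1 *: ((-2 *: rk s + v s) + rp s)).
  by apply/funext => s; rewrite /D2 scaleNr (addrC (- _)).
by apply/vsqintZ/vsqint_sum => //; exact: vsqint_lin.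
Qed.

Local Opaque L2ip L2norm dssv dsv.

Lemma L2ip_lin_sqr (c : R) v w : vsqint L v -> vsqint L w ->
  L2ip L (fun s => c *: v s + w s) (fun s => c *: v s + w s) =
  c ^+ 2 * L2ip L v v + 2 * c * L2ip L w v + L2ip L w w.
Proof.
move=> hv hw; rewrite L2ip_linr //; last exact: vsqint_lin.
by rewrite !L2ip_linl // (L2ipC _ v w); ring.
Qed.

Lemma L2ip_dssv_lin_sqr (c : R) v w : H2v L v -> H2v L w ->
  L2norm L (dssv L (fun s => c *: v s + w s)) ^+ 2 =
  c ^+ 2 * L2norm L (dssv L v) ^+ 2 + 2 * c * L2ip L (dssv L w) (dssv L v)
  + L2norm L (dssv L w) ^+ 2.
Proof.
move=> hv hw; have hvw := dssv_sqint (H2v_lin c hv hw).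
have dv := dssv_sqint hv; have dw := dssv_sqint hw.
have E x (hx : vsqint L x) := L2ip_dssv_lin L0 c hx hv hw.
move: (dssv L (fun s => c *: v s + w s)) hvw E => Z hvw E.
move: (dssv L v) (dssv L w) dv dw E => dv dw sdv sdw E.
rewrite (L2norm_sqr L Z).
rewrite (L2norm_sqr L dv).
rewrite (L2norm_sqr L dw).
rewrite (E Z hvw) (L2ipC _ Z dv) (L2ipC _ Z dw) (E _ sdv) (E _ sdw).
by rewrite (L2ipC _ dv dw); ring.
Qed.

(** For nonzero [c], the choice t = -c / Q with Q > q gives (c / Q)^2 (q - Q) < 0. *)
Lemma linear_coef_eq0 (c q : R) : (forall t, 0 <= t * c + t ^+ 2 * q) -> c = 0.
Proof.
move=> K; apply/eqP/negPn/negP => c0; pose Q := `|q| + 1.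
have Q0 : 0 < Q by rewrite ltr_wpDl.
have qQ : q < Q by rewrite (le_lt_trans (ler_norm q)) // ltrDl.
have := K (- c / Q).
have -> : - c / Q * c + (- c / Q) ^+ 2 * q = (c / Q) ^+ 2 * (q - Q).
  by field; rewrite gt_eqF.
by rewrite leNgt nmulr_llt0 ?subr_lt0 // exprn_even_gt0 //= mulf_neq0 ?invr_eq0 // gt_eqF.
Qed.

Variables (omega b tau : R) (fk1 rp rk : R -> 'rV[R]_3).
Hypotheses (tau0 : tau != 0) (hf : vsqint L fk1) (hp : vsqint L rp) (hk : H2v L rk).

Notation J := (J L omega b tau fk1 rp rk).
Notation dJ := (dJ L omega b tau fk1 rp rk).

(** Exact second-order expansion. Adding [t *: phi] shifts tau D^2 by (t / tau) phi; in the cross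
    term the two powers of tau cancel, which is why [dJ] contains D^2 without the factor tau. *)
Lemma J_lin (t : R) phi v : H2v L phi -> H2v L v ->
  J (fun s => t *: phi s + v s) = J v + t * dJ v phi + t ^+ 2 *
    (omega * (tau ^-2 * L2ip L phi phi) + b * L2norm L (dssv L phi) ^+ 2).
Proof.
move=> hphi hv; have sphi := H2v_sqint hphi; have sv := H2v_sqint hv.
have sD : vsqint L (D2 tau rp rk v) by apply: D2_sqint => //; exact: H2v_sqint.
have sD' : vsqint L (fun s => tau *: D2 tau rp rk v s) by exact: vsqintZ.
have e1 : L2norm L (fun s => tau *: D2 tau rp rk (fun s => t *: phi s + v s) s) ^+ 2 =
    (t / tau) ^+ 2 * L2ip L phi phi + 2 * (t / tau) * (tau * L2ip L (D2 tau rp rk v) phi)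
    + L2norm L (fun s => tau *: D2 tau rp rk v s) ^+ 2.
  have -> : (fun s => tau *: D2 tau rp rk (fun s => t *: phi s + v s) s) =
            (fun s => (t / tau) *: phi s + tau *: D2 tau rp rk v s).
    apply/funext => s; rewrite /D2 !scalerA -!addrA (scalerDr (tau * _)) scalerA.
    by congr (_ *: _ + _); field.
  apply: etrans (L2norm_sqr _ _) _; apply: etrans (L2ip_lin_sqr (t / tau) sphi sD') _.
  by congr (_ + _ * _ + _); [exact: L2ipZl|rewrite L2norm_sqr].
have e2 := L2ip_dssv_lin_sqr t hphi hv.
have e3 := L2ip_linr t hf sphi sv.
transitivity (omega * ((t / tau) ^+ 2 * L2ip L phi phi +
    2 * (t / tau) * (tau * L2ip L (D2 tau rp rk v) phi)
    + L2norm L (fun s => tau *: D2 tau rp rk v s) ^+ 2) +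
  b * (t ^+ 2 * L2norm L (dssv L phi) ^+ 2 + 2 * t * L2ip L (dssv L v) (dssv L phi)
    + L2norm L (dssv L v) ^+ 2) - 2 * (t * L2ip L fk1 phi + L2ip L fk1 v)).
  by congr (omega * _ + b * _ - 2 * _).
have ring_id (x1 x2 x3 x4 x5 x6 x7 x8 : R) :
    omega * ((t / tau) ^+ 2 * x1 + 2 * (t / tau) * (tau * x2) + x4 ^+ 2)
    + b * (t ^+ 2 * x3 ^+ 2 + 2 * t * x5 + x6 ^+ 2) - 2 * (t * x7 + x8) =
    (omega * x4 ^+ 2 + b * x6 ^+ 2 - 2 * x8) + t * (2 * (omega * x2 + b * x5 - x7))
    + t ^+ 2 * (omega * (tau ^-2 * x1) + b * x3 ^+ 2) by field.
exact: (ring_id (L2ip L phi phi) (L2ip L (D2 tau rp rk v) phi) (L2norm L (dssv L phi))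
  (L2norm L (fun s => tau *: D2 tau rp rk v s)) (L2ip L (dssv L v) (dssv L phi))
  (L2norm L (dssv L v)) (L2ip L fk1 phi) (L2ip L fk1 v)).
Qed.

Lemma dJ_lin (a : R) v phi psi : H2v L v -> H2v L phi -> H2v L psi ->
  dJ v (fun s => a *: phi s + psi s) = a * dJ v phi + dJ v psi.
Proof.
move=> hv hphi hpsi; have sphi := H2v_sqint hphi; have spsi := H2v_sqint hpsi.
have sD : vsqint L (D2 tau rp rk v).
  by apply: D2_sqint => //; exact: H2v_sqint.
have e1 := L2ip_linr a sD sphi spsi; have e2 := L2ip_linr a hf sphi spsi.
have e3 := L2ip_dssv_lin L0 a (dssv_sqint hv) hphi hpsi.
transitivity (2 * (omega * (a * L2ip L (D2 tau rp rk v) phi + L2ip L (D2 tau rp rk v) psi)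
  + b * (a * L2ip L (dssv L v) (dssv L phi) + L2ip L (dssv L v) (dssv L psi))
  - (a * L2ip L fk1 phi + L2ip L fk1 psi))); first by congr (2 * (omega * _ + b * _ - _)).
have ring_id (x1 x2 x3 x4 x5 x6 : R) :
    2 * (omega * (a * x1 + x2) + b * (a * x3 + x4) - (a * x5 + x6)) =
    a * (2 * (omega * x1 + b * x3 - x5)) + 2 * (omega * x2 + b * x4 - x6) by ring.
exact: (ring_id (L2ip L (D2 tau rp rk v) phi) (L2ip L (D2 tau rp rk v) psi)
  (L2ip L (dssv L v) (dssv L phi)) (L2ip L (dssv L v) (dssv L psi))
  (L2ip L fk1 phi) (L2ip L fk1 psi)).
Qed.

Lemma eq_dJ v phi psi : (forall s, 0 < s < L -> phi s = psi s) -> dJ v phi = dJ v psi.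
Proof.
move=> e; have e1 x : L2ip L x phi = L2ip L x psi by exact: eq_L2ipr.
have e2 : dssv L phi = dssv L psi by exact: eq_dssv.
by rewrite /Defs.dJ e2; congr (2 * (omega * _ + _ - _)).
Qed.

Lemma minimizer_stationary eg v phi : minimizer J (feasible L eg rk) v -> H2v_0L L phi ->
  (forall s, 0 < s < L -> dot (dsv L phi s) (dsv L rk s) = 0) -> dJ v phi = 0.
Proof.
move=> [[[hv vL dvL] cv] vmin] [hphi phiL dphiL] orth.
set q := omega * (tau ^-2 * L2ip L phi phi) + b * L2norm L (dssv L phi) ^+ 2.
have K (t : R) : 0 <= t * dJ v phi + t ^+ 2 * q.
  have := vmin (fun s => t *: phi s + v s); rewrite J_lin // -/q -addrA lerDl; apply.
  have LL := lexx L; have L0' := ltW L0.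
  split; first split.
  - exact: H2v_lin.
  - by rewrite phiL vL scaler0 addr0.
  - by rewrite dsv_lin // dphiL dvL scaler0 add0r.
  move=> s sI; have := cv s sI; move: sI; rewrite in_itv /= => sI.
  have [/ltW s0 /ltW sL] := andP sI; rewrite /constr.
  rewrite (dsv_sub (H2v_lin t hphi hv) hk s0 sL) (dsv_sub hv hk s0 sL).
  by rewrite (dsv_lin t hphi hv s0 sL) -addrA dot_linl orth // mulr0 add0r.
exact: linear_coef_eq0 K.
Qed.

End first_variation.

(** * The right inverse of the constraint *)

Section multiplier_bound.
Context {R : realType} (L : R) (L0 : 0 < L).
Notation prim := (@prim R L).
Implicit Types (g h : R -> R) (v w phi psi : R -> 'rV[R]_3).

Lemma coord_row (F : 'I_3 -> R -> R) i : coord (fun s => \row_j F j s) i = F i.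
Proof. by apply/funext => s; rewrite /Defs.coord mxE. Qed.

Lemma prim_sum (r : seq 'I_3) (u u' : 'I_3 -> R -> R) : (forall i, prim (u i) (u' i)) ->
  prim (fun s => \sum_(i <- r) u i s) (fun s => \sum_(i <- r) u' i s).
Proof.
move=> pu; elim: r => [|i r IH].
  have e (F : 'I_3 -> R -> R) : (fun s => \sum_(i <- [::]) F i s) = (fun=> 0).
    by apply/funext => s; rewrite big_nil.
  by rewrite !e; exact: prim_cst.
have e (F : 'I_3 -> R -> R) : (fun s => \sum_(j <- i :: r) F j s) =
    (fun s => F i s + \sum_(j <- r) F j s).
  by apply/funext => s; rewrite big_cons.
by rewrite !e; exact: primD.
Qed.

Lemma prim_dot v v' w w' : vprim L v v' -> vprim L w w' ->
  prim (fun s => dot (v s) (w s))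
    (fun s => \sum_(i < 3) (coord w i s * coord v' i s + coord v i s * coord w' i s)).
Proof.
by move=> pv pw; exact: (prim_sum (index_enum 'I_3) (fun i => primM (pv i) (pw i))).
Qed.

(** Cauchy-Schwarz by components, arranged so that the constant depends on [v] and [C] only and the
    bound is linear in [N], as an operator norm estimate requires. *)
Lemma L2ip_bound v w (C N : R) : vsqint L v -> vsqint L w -> 0 <= C -> 0 <= N ->
  (forall i, \int_[0, L] (fun s => coord w i s ^+ 2) <= C * N ^+ 2) ->
  `|L2ip L v w| <=
  (\sum_(i < 3) Num.sqrt (\int_[0, L] (fun s => coord v i s ^+ 2) * C)) * N.
Proof.
move=> hv hw C0 N0 hwC; rewrite L2ipE //.
rewrite (le_trans (ler_norm_sum _ _ _)) // mulr_suml; apply: ler_sum => i _.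
have v0 : 0 <= \int_[0, L] (fun s => coord v i s ^+ 2).
  by apply: Rintegral_ge0 => s _; exact: sqr_ge0.
have -> : Num.sqrt (\int_[0, L] (fun s => coord v i s ^+ 2) * C) * N =
    Num.sqrt (\int_[0, L] (fun s => coord v i s ^+ 2) * C * N ^+ 2).
  by rewrite [RHS]sqrtrM ?mulr_ge0 // sqrtr_sqr ger0_norm.
rewrite -sqrtr_sqr ler_sqrt; last by rewrite mulr_ge0 ?sqr_ge0 // mulr_ge0.
rewrite (le_trans (cauchy_schwarz (measurable_itv _) (hv i) (hw i))) //.
by rewrite -mulrA ler_wpM2l.
Qed.

Variable rk : R -> 'rV[R]_3.
Hypotheses (hk : H2v L rk)
  (hk1 : forall s, 0 <= s -> s <= L -> 1 <= dot (dsv L rk s) (dsv L rk s)).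

(* The components of [\partial_s r_k / (2 |\partial_s r_k|^2)]. *)
Definition tangent_weight i s := coord (dsv L rk) i s *
  (2^-1 * (dot (dsv L rk s) (dsv L rk s))^-1).
Local Notation q := tangent_weight.

Lemma prim_tangent_weight : exists q' : 'I_3 -> R -> R, forall i, prim (q i) (q' i).
Proof.
have [_ pd] := H2v_prim L0 hk.
have pm := primV (prim_dot pd pd) hk1.
by eexists => i; exact: primM (pd i) (primZ 2^-1 pm).
Qed.

(** With M = |\partial_s r_k|^2, the square is at most M / (4 M^2), and M >= 1. *)
Lemma tangent_weight_sqr_le1 i s : 0 <= s -> s <= L -> q i s ^+ 2 <= 1.
Proof.
move=> s0 sL; have := hk1 s0 sL; rewrite /q; set M := dot _ _ => M1.
have M0 : 0 < M by rewrite (lt_le_trans ltr01).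
have cM : coord (dsv L rk) i s ^+ 2 <= M.
  rewrite /M /dot (bigD1 i) //= -expr2 lerDl; apply: sumr_ge0 => j _.
  by rewrite -expr2 sqr_ge0.
have -> : (coord (dsv L rk) i s * (2^-1 * M^-1)) ^+ 2 =
  coord (dsv L rk) i s ^+ 2 / (4 * M ^+ 2) by field; rewrite gt_eqF.
rewrite ler_pdivrMr ?mulr_gt0 ?exprn_gt0 // mul1r (le_trans cM) //.
by nra.
Qed.

Lemma tangent_weight_dot s : 0 <= s -> s <= L ->
  \sum_(i < 3) q i s * coord (dsv L rk) i s = 2^-1.
Proof.
move=> s0 sL; have M0 : dot (dsv L rk s) (dsv L rk s) != 0.
  by rewrite gt_eqF // (lt_le_trans ltr01) ?hk1.
rewrite -[RHS](mulfK M0) -mulrA mulrCA mulr_suml; apply: eq_bigr => i _.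
by rewrite /q /Defs.coord mulrAC.
Qed.

Lemma constr'_invE g g' i s : prim g g' -> 0 <= s -> s <= L ->
  coord (constr'_inv L rk g) i s = - \int_[s, L] (fun u => g u * q i u).
Proof.
move=> pg s0 sL; have [q' pq] := prim_tangent_weight.
have cgq := prim_continuous (primM pg (pq i)).
have igq : mu.-integrable `[s, L] (EFin \o (fun u => g u * q i u)).
  apply: continuous_compact_integrable; first exact: segment_compact.
  by apply: continuous_subspaceW cgq; apply: subset_itvr; rewrite bnd_simp.
rewrite /Defs.coord mxE; congr (- _).
rewrite Rintegral_itv_obnd_cbnd; last first.
  by apply: integrableS igq => //; exact: subset_itv_oo_cc.
rewrite Rintegral_itv_bndo_bndc; last first.
  by apply: integrableS igq => //; exact: subset_itv_co_cc.
apply: eq_Rintegral => u _.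
have -> : enorm (dsv L rk u) ^+ 2 = dot (dsv L rk u) (dsv L rk u).
  rewrite sqr_sqrtr //; apply: sumr_ge0 => j _; by rewrite -expr2 sqr_ge0.
by rewrite invfM -mulrA.
Qed.

Lemma constr'_inv_prim g g' (q' : 'I_3 -> R -> R) : prim g g' ->
  (forall i, prim (q i) (q' i)) ->
  vprim L (constr'_inv L rk g) (fun s => \row_i (g s * q i s)) /\
  vprim L (fun s => \row_i (g s * q i s)) (fun s => \row_i (q i s * g' s + g s * q' i s)).
Proof.
move=> pg pq.
have pgq i : prim (fun s => g s * q i s) (fun s => q i s * g' s + g s * q' i s).
  exact: primM.
split=> i.
  rewrite (coord_row (fun i s => g s * q i s)).
  have := prim_int (prim_sqint_fun (pgq i)).
  by apply: (eq_prim (ltW L0)) => s s0 sL; rewrite (constr'_invE _ pg).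
by rewrite (coord_row (fun i s => g s * q i s)) (coord_row (fun i s => q i s * g' s + g s * q' i s)).
Qed.

Lemma constr'_inv_H2v_0L g : H1_0L L g -> H2v_0L L (constr'_inv L rk g).
Proof.
move=> [/(H1_prim_wds L0) pg gL]; have [q' pq] := prim_tangent_weight.
have [p1 p2] := constr'_inv_prim pg pq.
split; first exact: vprim_H2v p1 p2.
- apply/rowP => i; rewrite -[LHS]/(coord (constr'_inv L rk g) i L).
  by rewrite (constr'_invE _ pg) ?lexx ?ltW // Rintegral_ooxx oppr0 mxE.
- rewrite (dsv_prim L0 p1 p2) ?lexx ?ltW //; apply/rowP => i.
  by rewrite !mxE gL mul0r.
Qed.

(** The derivative of [constr'_inv L rk g] is g q, and q . \partial_s r_k = 1/2; the half
    compensates the factor 2 in the derivative of the constraint. *)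
Lemma constr'_inv_right_inverse g : H1_0L L g -> forall s, 0 <= s -> s <= L ->
  dot (dsv L (constr'_inv L rk g) s) (dsv L rk s) = g s / 2.
Proof.
move=> [/(H1_prim_wds L0) pg gL] s s0 sL; have [q' pq] := prim_tangent_weight.
have [p1 p2] := constr'_inv_prim pg pq.
rewrite (dsv_prim L0 p1 p2) // -(tangent_weight_dot s0 sL) mulr_sumr.
by apply: eq_bigr => i _; rewrite mxE mulrA.
Qed.

Lemma constr'_inv_lin (a : R) g h s : H1_0L L g -> H1_0L L h -> 0 <= s -> s <= L ->
  constr'_inv L rk (fun t => a * g t + h t) s =
  a *: constr'_inv L rk g s + constr'_inv L rk h s.
Proof.
move=> [/(H1_prim_wds L0) pg _] [/(H1_prim_wds L0) ph _] s0 sL.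
have [q' pq] := prim_tangent_weight.
apply/rowP => i; rewrite [RHS]mxE [X in _ = X + _]mxE.
have := constr'_invE i (primD (primZ a pg) ph) s0 sL.
have := constr'_invE i pg s0 sL; have := constr'_invE i ph s0 sL.
rewrite /Defs.coord => -> -> ->.
have ig : mu.-integrable `]s, L[ (EFin \o (fun u => g u * q i u)).
  by apply: (integrable_sub_oo s0 (lexx L)); apply/sqint_integrable/(prim_sqint_fun (primM pg (pq i))).
have ih : mu.-integrable `]s, L[ (EFin \o (fun u => h u * q i u)).
  by apply: (integrable_sub_oo s0 (lexx L)); apply/sqint_integrable/(prim_sqint_fun (primM ph (pq i))).
rewrite mulrN -opprD -RintegralZl // -RintegralD //; last exact: integrable_scaler.
by congr (- _); apply: eq_Rintegral => u _; rewrite mulrDl mulrA.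
Qed.

Lemma Rintegral_le (f1 f2 : R -> R) : sqint `]0, L[ f1 -> mu.-integrable `]0, L[ (EFin \o f2) ->
  (forall s, 0 < s < L -> f1 s ^+ 2 <= f2 s) -> \int_[0, L] (fun s => f1 s ^+ 2) <= \int_[0, L] f2.
Proof.
by move=> [_ i1] i2 le12; apply: le_Rintegral.
Qed.

(** [dJ] involves its direction only through the values and the second derivative, so just these two
    are bounded. In the constant, [L ^+ 2] comes from integrating (\int g q)^2 <= L \int g^2 over
    the interval, [2] from the term q g', and [2 * L * K] from g q' with the sup bound on g. *)
Lemma constr'_inv_bound (q' : 'I_3 -> R -> R) : (forall i, prim (q i) (q' i)) ->
  exists2 C : R, 0 <= C & forall g, H1_0L L g -> forall i,
  \int_[0, L] (fun s => coord (constr'_inv L rk g) i s ^+ 2) <= C * H1norm L g ^+ 2 /\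
  \int_[0, L] (fun s => (q i s * wds L g s + g s * q' i s) ^+ 2) <= C * H1norm L g ^+ 2.
Proof.
move=> pq.
have int_sqr_ge0 (f : R -> R) : 0 <= \int_[0, L] (fun s => f s ^+ 2).
  by apply: Rintegral_ge0 => s _; exact: sqr_ge0.
have L0' := ltW L0.
have num1 (A B K : R) : 0 <= A -> 0 <= B -> 0 <= K ->
    L * A * L <= (L ^+ 2 + 2 + 2 * L * K) * (A + B).
  move=> A0 B0 K0; have h1 := mulr_ge0 (mulr_ge0 L0' K0) A0.
  have h2 := mulr_ge0 (mulr_ge0 L0' K0) B0; have h3 := mulr_ge0 (sqr_ge0 L) B0.
  by lra.
have num2 (A B K X : R) : 0 <= A -> 0 <= B -> 0 <= K -> X <= K ->
    2 * B + 2 * (L * B) * X <= (L ^+ 2 + 2 + 2 * L * K) * (A + B).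
  move=> A0 B0 K0 XK; have h1 := mulr_ge0 (mulr_ge0 L0' K0) A0.
  have h2 := ler_wpM2l (mulr_ge0 L0' B0) XK; have h3 := mulr_ge0 (sqr_ge0 L) B0.
  have h4 := mulr_ge0 (sqr_ge0 L) A0.
  by lra.
pose K := \sum_(i < 3) \int_[0, L] (fun s => q' i s ^+ 2).
have K0 : 0 <= K by apply: sumr_ge0.
exists (L ^+ 2 + 2 + 2 * L * K) => [|g g0 i].
  by rewrite !addr_ge0 ?sqr_ge0 // !mulr_ge0.
have [/(H1_prim_wds L0) pg gL] := g0; have hg := prim_sqint_fun pg; have [hg' _] := pg.
rewrite /H1norm sqr_sqrtr; last by rewrite addr_ge0.
set A := \int_[0, L] (fun s => g s ^+ 2); set B := \int_[0, L] (fun s => wds L g s ^+ 2).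
have A0 : 0 <= A by exact: int_sqr_ge0.
have B0 : 0 <= B by exact: int_sqr_ge0.
have cint (c : R) : \int_[0, L] (fun=> c) = c * L.
  by rewrite Rintegral_cst //= lebesgue_measure_itv /= lte_fin L0 /= subr0.
have icst (c : R) : mu.-integrable `]0, L[ (EFin \o (fun=> c)).
  exact/sqint_integrable/sqint_cst.
have hgq : sqint `]0, L[ (fun s => g s * q i s) := prim_sqint_fun (primM pg (pq i)).
have AB : \int_[0, L] (fun s => (g s * q i s) ^+ 2) <= A.
  apply: Rintegral_le => //; first by case: hg.
  move=> s /andP[/ltW s0 /ltW sL]; rewrite exprMn ler_piMr ?sqr_ge0 //.
  exact: tangent_weight_sqr_le1.
split.
  apply: (@le_trans _ _ (L * A * L)).
    rewrite -cint; apply: Rintegral_le => //.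
      have [p1 _] := constr'_inv_prim pg pq; exact: prim_sqint_fun (p1 i).
    move=> s /andP[/ltW s0 /ltW sL]; rewrite (constr'_invE _ pg) // sqrrN.
    rewrite (le_trans (Rintegral_oo_sqr_le hgq s0 sL (lexx L))) //.
    by apply: ler_pM => //; [rewrite subr_ge0|rewrite gerBl].
  exact: num1.
have hq' : sqint `]0, L[ (q' i) by case: (pq i).
apply: (@le_trans _ _ (2 * B + 2 * (L * B) * \int_[0, L] (fun s => q' i s ^+ 2))).
  have iB : mu.-integrable `]0, L[ (EFin \o (fun s => 2 * wds L g s ^+ 2)).
    by apply: integrable_scaler => //; case: hg'.
  have iq : mu.-integrable `]0, L[ (EFin \o (fun s => 2 * (L * B) * q' i s ^+ 2)).
    by apply: integrable_scaler => //; case: hq'.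
  have [_ ig2] := hg'; have [_ iq2] := hq'.
  have <- : \int_[0, L] (fun s => 2 * wds L g s ^+ 2) = 2 * B by exact: RintegralZl.
  have <- : \int_[0, L] (fun s => 2 * (L * B) * q' i s ^+ 2) =
      2 * (L * B) * \int_[0, L] (fun s => q' i s ^+ 2) by exact: RintegralZl.
  rewrite -(RintegralD _ iB iq) //; apply: Rintegral_le.
  - by have [] := primM pg (pq i).
  - exact: integrable_addr.
  move=> s /andP[/ltW s0 /ltW sL].
  have q1 := tangent_weight_sqr_le1 i s0 sL.
  (* Here the boundary value [g L = 0] enters: g(s) is minus the integral of its derivative over
     []s, L[]. *)
  have gB : g s ^+ 2 <= L * B.
    have := primB pg s0 sL (lexx L); rewrite gL sub0r => /(congr1 (fun x => x ^+ 2)).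
    rewrite sqrrN => ->; rewrite (le_trans (Rintegral_oo_sqr_le hg' s0 sL (lexx L))) //.
    by rewrite ler_wpM2r // gerBl.
  have e1 : (q i s * wds L g s) ^+ 2 <= wds L g s ^+ 2.
    by rewrite exprMn ler_piMl ?sqr_ge0.
  have e2 : (g s * q' i s) ^+ 2 <= (L * B) * q' i s ^+ 2.
    by rewrite exprMn ler_wpM2r ?sqr_ge0.
  move: (q i s * wds L g s) (g s * q' i s) (wds L g s ^+ 2) e1 e2 => x y z.
  rewrite -mulrA; move: (L * B * q' i s ^+ 2) => t; clear => e1 e2.
  by have := sqr_ge0 (x - y); nra.
have qK : \int_[0, L] (fun s => q' i s ^+ 2) <= K.
  by rewrite /K (bigD1 i) //= lerDl; apply: sumr_ge0.
exact: num2.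
Qed.

End multiplier_bound.

(** * The discrete fiber system *)

Section discrete_fiber_system.
Context {R : realType} (L : R) (L0 : 0 < L).
Implicit Types (v w phi : R -> 'rV[R]_3) (eg : 'rV[R]_3).

(** The invariant propagated along the time steps; the lower bound on the closed interval is what
    makes the reciprocal of |\partial_s r_k|^2 differentiable. *)
Definition unstretched eg v := admissible L eg v /\
  forall s, 0 <= s -> s <= L -> 1 <= dot (dsv L v s) (dsv L v s).

Lemma prim_id : prim L (fun s => s) (fun=> 1).
Proof.
split; first exact: sqint_cst.
move=> s s0; rewrite le_eqVlt => /predU1P[->|sL]; first by rewrite Rintegral_ooxx subr0.
rewrite Rintegral_cst //= lebesgue_measure_itv /= lte_fin sL /= mul1r.
by rewrite opprB addrC subrK.
Qed.

Lemma unstretched_affine eg v : enorm eg = 1 ->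
  (forall s, s \in `[0, L] -> v s = (L - s) *: eg) -> unstretched eg v.
Proof.
move=> eg1 vE; have vE' s : 0 <= s -> s <= L -> v s = (L - s) *: eg.
  by move=> s0 sL; rewrite vE // in_itv /= s0.
have p1 : vprim L v (fun=> - eg).
  move=> i; have p := prim_sub (prim_cst L (L * eg ord0 i)) (primZ (eg ord0 i) prim_id).
  have -> : coord (fun=> - eg) i = (fun x : R => 0 - eg ord0 i * 1).
    by apply/funext => s; rewrite /Defs.coord mxE mulr1 sub0r.
  apply: (eq_prim (ltW L0) _ p) => s s0 sL.
  by rewrite /Defs.coord vE' // mxE; ring.
have p2 : vprim L (fun=> - eg) (fun=> 0).
  move=> i; have -> : coord (fun=> 0) i = (fun=> 0 : R).
    by apply/funext => s; rewrite /Defs.coord mxE.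
  exact: prim_cst.
have dE := dsv_prim L0 p1 p2; have L0' := ltW L0; have LL := lexx L.
split; first split.
- exact: vprim_H2v p1 p2.
- by rewrite vE' // subrr scale0r.
- exact: dE.
move=> s s0 sL; rewrite dE //.
have -> : dot (- eg) (- eg) = enorm eg ^+ 2; last by rewrite eg1 expr1n.
rewrite sqr_sqrtr; last by apply: sumr_ge0 => i _; rewrite -expr2 sqr_ge0.
by apply: eq_bigr => i _; rewrite !mxE mulrNN.
Qed.

(* Pythagoras: the increment is orthogonal to [dsv L rk], so lengths of tangents
   never decrease. *)
Lemma feasible_unstretched eg rk v : unstretched eg rk -> feasible L eg rk v ->
  unstretched eg v.
Proof.
move=> [[hk _ _] rk1] [av cv]; split=> //; have [hv _ _] := av.
have [_ pd] := H2v_prim L0 hv.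
apply: (prim_ge_closure L0 (prim_dot pd pd)) => s sI.
have [/ltW s0 /ltW sL] := andP sI.
have := cv s; rewrite in_itv /= => /(_ sI); rewrite /constr (dsv_sub L0 hv hk s0 sL).
have := rk1 s s0 sL.
move: (dsv L rk s) (dsv L v s) => x z x1 zx.
have := dotDsqr x (z - x); rewrite addrC subrK (dotC x) => ->.
have y0 : 0 <= dot (z - x) (z - x) by apply: sumr_ge0 => i _; rewrite -expr2 sqr_ge0.
by move: zx x1 y0; move: (dot _ _) (dot _ _) (dot _ _) => A B C; lra.
Qed.

Lemma sqint_slice (T t : R) (f : R * R -> 'rV[R]_3) :
  {within `[0, L] `*` `[0, T], continuous f} -> 0 <= t -> t <= T ->
  vsqint L (fun s => f (s, t)).
Proof.
move=> /subspace_continuousP cf t0 tT i; apply: sqint_continuous.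
apply/subspace_continuousP => x xI.
have xtI : (`[0, L] `*` `[0, T]) (x, t) by split => //=; rewrite in_itv /= t0.
have c1 : f (s, t) @[s --> within `[0, L]%classic (nbhs x)] --> f (x, t).
  apply: cvg_trans (cf _ xtI) => P /=.
  rewrite !nbhs_simpl /= => HP.
  have cp : (fun s : R => (s, t)) @ x --> (x, t).
    exact: (@cvg_pair _ _ _ (nbhs x) (nbhs x) (nbhs t) _ _ _ id (fun=> t) (@cvg_id _ _) (@cvg_cst _ _ _ _ _)).
  have := cp _ HP; rewrite nbhs_simpl /=; apply: filterS => s H sI.
  by apply: H; split => //=; rewrite in_itv /= t0.
have c2 := @coord_continuous R 1 3 ord0 i (f (x, t)).
exact: (cvg_comp _ _ c1 c2).
Qed.

Variables (omega b tau : R) (fk1 rp rk rn : R -> 'rV[R]_3) (eg : 'rV[R]_3).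
Hypotheses (tau0 : tau != 0) (hf : vsqint L fk1) (hp : H2v L rp)
  (urk : unstretched eg rk) (hn : H2v L rn).

Notation dJ := (dJ L omega b tau fk1 rp rk rn).
Notation lam := (multiplier L omega b tau fk1 rp rk rn).

Let hk : H2v L rk. Proof. by case: urk => -[]. Qed.
Let rk1 s : 0 <= s -> s <= L -> 1 <= dot (dsv L rk s) (dsv L rk s).
Proof. by case: urk => _; exact. Qed.
Let sp := H2v_sqint L0 hp.
Let sD : vsqint L (D2 tau rp rk rn).
Proof. by apply: D2_sqint => //; exact: H2v_sqint. Qed.

Local Opaque L2ip L2norm dssv dsv.

Lemma multiplier_Hm1 : Hm1 L lam.
Proof.
split=> [a g h hg hh|].
  have [eg0 _ _] := constr'_inv_H2v_0L L0 hk rk1 hg.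
  have [eh0 _ _] := constr'_inv_H2v_0L L0 hk rk1 hh.
  have e1 : dJ (constr'_inv L rk (fun s => a * g s + h s)) =
      dJ (fun s => a *: constr'_inv L rk g s + constr'_inv L rk h s).
    by apply: eq_dJ => s /andP[/ltW s0 /ltW sL]; exact: constr'_inv_lin.
  have e2 := dJ_lin L0 omega b tau hf sp hk a hn eg0 eh0.
  have ring_id (x y : R) : - (a * x + y) = a * - x + - y by ring.
  by apply: etrans (congr1 -%R (etrans e1 e2)) _; exact: ring_id.
have [q' pq] := prim_tangent_weight L0 hk rk1.
have [C C0 HC] := constr'_inv_bound L0 hk rk1 pq.
pose S v := \sum_(i < 3) Num.sqrt (\int[@lebesgue_measure R]_(s in `]0, L[) (coord v i s ^+ 2) * C).
exists (2 * (`|omega| * S (D2 tau rp rk rn) + `|b| * S (dssv L rn) + S fk1)) => g hg.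
have [/(H1_prim_wds L0) pg _] := hg.
have [p1 p2] := constr'_inv_prim L0 hk rk1 pg pq.
have s1 := vprim_sqint p1; have s2 := vprim_sqint_derivative p2.
have N0 : 0 <= H1norm L g by exact: sqrtr_ge0.
have HC1 i := (HC g hg i).1.
have b1 := L2ip_bound sD s1 C0 N0 HC1.
have b3 := L2ip_bound hf s1 C0 N0 HC1.
have sB := dssv_sqint L0 hn.
have [h0 _ _] := constr'_inv_H2v_0L L0 hk rk1 hg.
have b2 : `|L2ip L (dssv L rn) (dssv L (constr'_inv L rk g))| <= S (dssv L rn) * H1norm L g.
  (* The chosen second derivative is replaced by the explicit q g' + g q', for which the norm bound
     is available. *)
  have -> := L2ip_aer sB (dssv_sqint L0 h0) s2 (dssv_prim_ae L0 p1 p2).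
  apply: (L2ip_bound sB s2 C0 N0) => i.
  by rewrite (coord_row (fun i s => _)); exact: (HC g hg i).2.
have bound_id (x y z Sx Sy Sz N : R) : `|x| <= Sx * N -> `|y| <= Sy * N -> `|z| <= Sz * N ->
    `|- (2 * (omega * x + b * y - z))| <= 2 * (`|omega| * Sx + `|b| * Sy + Sz) * N.
  move=> hx hy hz; rewrite normrN normrM ger0_norm // -mulrA ler_wpM2l //.
  rewrite (le_trans (ler_normB _ _)) // !mulrDl; apply: lerD => //.
  rewrite (le_trans (ler_normD _ _)) // !normrM -!mulrA.
  by apply: lerD; apply: ler_wpM2l.
exact: (bound_id _ _ _ _ _ _ _ b1 b2 b3).
Qed.

Lemma multiplier_weak_equation phi :
  minimizer (J L omega b tau fk1 rp rk) (feasible L eg rk) rn -> H2v_0L L phi ->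
  omega * L2ip L (D2 tau rp rk rn) phi =
  - dual_pairing (fun s => dot (dsv L rk s) (dsv L phi s)) lam
  - b * L2ip L (dssv L rn) (dssv L phi) + L2ip L fk1 phi.
Proof.
move=> rmin [hphi phiL dphiL]; set g := fun s => dot (dsv L rk s) (dsv L phi s).
have [_ pk] := H2v_prim L0 hk; have [_ pphi] := H2v_prim L0 hphi.
have hg : H1_0L L g.
  (* Membership in the domain of the multiplier also needs g(L) = 0, which follows from \partial_s
     phi(L) = 0. *)
  split; first exact: prim_H1 (prim_dot pk pphi).
  by rewrite /g dphiL; apply: big1 => i _; rewrite [X in _ * X]mxE mulr0.
have [heta etaL detaL] := constr'_inv_H2v_0L L0 hk rk1 hg.
set eta := constr'_inv L rk g in heta etaL detaL.
have L0' := ltW L0.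
have := minimizer_stationary L0 tau0 hf sp hk (phi := fun s => (-2) *: eta s + phi s) rmin.
rewrite (dJ_lin L0 omega b tau hf sp hk (-2) hn heta hphi) => K.
have {K} K : -2 * dJ eta + dJ phi = 0.
  apply: K; first split.
  - exact: H2v_lin.
  - by rewrite etaL phiL scaler0 addr0.
  - by rewrite (dsv_lin L0 (-2) heta hphi L0' (lexx L)) detaL dphiL scaler0 addr0.
  move=> s /andP[/ltW s0 /ltW sL].
  rewrite (dsv_lin L0 (-2) heta hphi s0 sL) dot_linl.
  rewrite (constr'_inv_right_inverse L0 hk rk1 hg s0 sL) (dotC (dsv L phi s)) -/(g s).
  by field.
(* Here [l] stands for [dJ eta], so the pairing is [- l]; dividing by two, the common factor of
   [dJ phi] and of the coefficient of [eta], gives the equation. *)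
have id (x y z l : R) : -2 * l + 2 * (omega * x + b * y - z) = 0 ->
  omega * x = - - l - b * y + z by lra.
exact: id K.
Qed.

End discrete_fiber_system.

Theorem theorem7 (R : realType) (L T omega b : R) (eg : 'rV[R]_3)
    (f : R * R -> 'rV[R]_3) (N : nat) (r : nat -> R -> 'rV[R]_3)
    (hL : 0 < L) (hT : 0 < T) (homega : 0 < omega) (hb : 0 < b)
    (heg : enorm eg = 1)
    (hf : {within `[0, L] `*` `[0, T], continuous f})
    (hN : (0 < N)%N) :
  let tau := T / N%:R in
  let fk := fun (k : nat) (s : R) => f (s, k%:R * tau) in
  (forall s, s \in `[0, L] -> r 0%N s = (L - s) *: eg) ->
  (forall s, s \in `[0, L] -> r 1%N s = (L - s) *: eg) ->
  (forall k, (0 < k < N)%N ->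
     minimizer (J L omega b tau (fk k.+1) (r k.-1) (r k))
       (feasible L eg (r k)) (r k.+1)) ->
  forall k, (0 < k < N)%N ->
  let lam := multiplier L omega b tau (fk k.+1) (r k.-1) (r k) (r k.+1) in
  [/\ Hm1 L lam,
      forall phi : R -> 'rV[R]_3, H2v_0L L phi ->
        omega * L2ip L (D2 tau (r k.-1) (r k) (r k.+1)) phi =
        - dual_pairing (fun s => dot (dsv L (r k) s) (dsv L phi s)) lam
        - b * L2ip L (dssv L (r k.+1)) (dssv L phi)
        + L2ip L (fk k.+1) phi
    & forall s, s \in `]0, L[ ->
        dot (dsv L (fun t => r k.+1 t - r k t) s) (dsv L (r k) s) = 0].
Proof.
move=> tau fk r0 r1 rmin k kN.
have N0 : (0 : R) < N%:R by rewrite ltr0n.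
have tau_gt0 : 0 < tau by rewrite divr_gt0.
(* Indices 0 and 1 are both base cases. Although the scheme is two-step, the constraint refers to
   the current curve only, so one predecessor suffices in the induction. *)
have ur (j : nat) : (j <= N)%N -> unstretched L eg (r j).
  case: j => [_|]; first exact: unstretched_affine.
  elim=> [_|j IH jN]; first exact: unstretched_affine.
  exact: (feasible_unstretched hL (IH (ltnW jN)) (rmin j.+1 jN).1).
have [k0 kltN] := andP kN.
have uk := ur k (ltnW kltN).
have [[hp _ _] _] := ur k.-1 (leq_trans (leq_pred k) (ltnW kltN)).
have [[hn _ _] _] := ur k.+1 kltN.
have hfk : vsqint L (fk k.+1).
  (* The time t_{k+1} must lie in [[0, T]]; this is [k < N]. *)
  apply: sqint_slice hf _ _; first by rewrite mulr_ge0 ?ltW.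
  by rewrite /tau mulrCA ger_pMr // ler_pdivrMr // mul1r ler_nat.
split.
- exact: (multiplier_Hm1 hL _ _ _ hfk hp uk hn).
- move=> phi; apply: (multiplier_weak_equation hL _ hfk hp uk hn (rmin k kN)).
  by rewrite gt_eqF.
move=> s sI; have [_ /(_ s sI)] := (rmin k kN).1.
by rewrite /constr => /eqP; rewrite mulf_eq0 pnatr_eq0 /= => /eqP.
Qed.
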